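(* Let $\mathcal{C}$ be the class of all pairs $(X,A)$ where $X$ is a Polish space and $A$ is an analytic relation on $X$ such that $A$ is contained in some symmetric acyclic relation on $X$ which is potentially $F_\sigma$, and such that there is no Borel countable coloring of $(X,A)$. Then $\{(1,1^2),\ (2^\omega,\mathbb{G}_0),\ (2^\omega,s(\mathbb{G}_0))\}$ is a $\sqsubseteq_c$-antichain basis for $\mathcal{C}$, where $(1,1^2)$ denotes the one-point space $\{0\}$ with the relation $\{(0,0)\}$. In particular: (i) $\mathbb{G}_0$ is minimum (for $\sqsubseteq_c$) among analytic oriented graphs on Polish spaces, contained in a potentially $F_\sigma$ acyclic graph, without Borel countable coloring; (ii) $s(\mathbb{G}_0)$ is minimum (for $\sqsubseteq_c$) among analytic graphs on Polish spaces, contained in a potentially $F_\sigma$ acyclic graph, without Borel countable coloring.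
   Context: All relations are binary. For a relation $A$ on $X$: $A^{-1}:=\{(x,y)\mid (y,x)\in A\}$, $s(A):=A\cup A^{-1}$; $A$ is symmetric if $A=A^{-1}$, antisymmetric if $A\cap A^{-1}\subseteq\Delta(X)=\{(x,x)\mid x\in X\}$, a digraph if irreflexive ($A\cap\Delta(X)=\emptyset$), a graph if irreflexive and symmetric, an oriented graph if irreflexive and antisymmetric; $A$ is acyclic if there is no injective sequence $(x_i)_{i\le n}$ with $n\ge2$, $(x_i,x_{i+1})\in A$ for $i<n$ and $(x_n,x_0)\in A$. A Borel countable coloring of $(X,A)$ is a Borel map $c:X\to\omega$ with $c(x)\ne c(y)$ whenever $(x,y)\in A$. A Borel set $B\subseteq X\times Y$ ($X,Y$ Polish) is potentially in a class $\Gamma$ (pot$(\Gamma)$) if there are finer Polish topologies $\sigma$ on $X$ and $\tau$ on $Y$ such that $B\in\Gamma((X,\sigma)\times(Y,\tau))$; a relation is said to be contained in a pot$(F_\sigma)$ relation if it is a subset of a Borel relation which is pot$(F_\sigma)$. For relations $A$ on $X$ and $B$ on $Y$ (topological spaces), $(X,A)\sqsubseteq_c(Y,B)$ means there is an injective continuous $f:X\to Y$ with $(f(x),f(y))\in B\iff(x,y)\in A$ for all $x,y\in X$. A subset $\mathcal{B}$ of a class $\mathcal{C}$ is a basis if every element of $\mathcal{C}$ is $\sqsubseteq_c$-above some element of $\mathcal{B}$, an antichain if its elements are pairwise $\sqsubseteq_c$-incomparable; an element $b$ is minimum in $\mathcal{C}$ if $b\in\mathcal{C}$ and $\{b\}$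 is a basis. Let $\psi:\omega\to 2^{<\omega}$ be the bijection listing finite binary sequences by increasing length and lexicographically within each length ($\psi(0)=\emptyset,\psi(1)=0,\psi(2)=1,\dots$), and $s_n:=\psi(n)0^{n-|\psi(n)|}$. Then $\mathbb{G}_0:=\{(s_n0\gamma,s_n1\gamma)\mid n\in\omega,\ \gamma\in2^\omega\}\subseteq 2^\omega\times2^\omega$. *)

(* Defs.v *)
From HB Require Import structures.
From mathcomp Require Import all_boot all_order all_algebra.
From mathcomp Require Import all_classical all_reals all_analysis borel_hierarchy.
Set Implicit Arguments.
Unset Strict Implicit.
Unset Printing Implicit Defensive.
Import Order.TTheory GRing.Theory Num.Theory.
Local Open Scope classical_set_scope.
Local Open Scope ring_scope.

Record is_metric (R : realType) (X : Type) (d : X -> X -> R) : Prop := IsMetric {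
  metric_eq0 : forall x y, d x y = 0 <-> x = y;
  metric_symm : forall x y, d x y = d y x;
  metric_tri : forall x y z, d x z <= d x y + d y z
}.

Definition metrizes (R : realType) (X : topologicalType) (d : X -> X -> R) :=
  forall U : set X, open U <->
    forall x, U x -> exists2 e, 0 < e & [set y | d x y < e] `<=` U.

Definition complete_metric (R : realType) (X : topologicalType)
    (d : X -> X -> R) :=
  forall u : nat -> X,
    (forall e, 0 < e -> exists N : nat, forall m n : nat,
       (N <= m)%N -> (N <= n)%N -> d (u m) (u n) < e) ->
    exists l : X, u @ \oo --> l.

Definition polish (R : realType) (X : topologicalType) :=
  (exists2 D : set X, countable D & dense D) /\
  (exists d : X -> X -> R, [/\ is_metric d, metrizes d & complete_metric d]).

Definition borel (X : topologicalType) (B : set X) := <<s @open X >> B.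

Definition borel_map (X Y : topologicalType) (f : X -> Y) :=
  forall U : set Y, open U -> borel (f @^-1` U).

Definition analytic (R : realType) (X : topologicalType) (A : set X) :=
  exists (Y : topologicalType) (f : Y -> X),
    [/\ polish R Y, continuous f & A = range f].

(* Topologies as data, so that a type which already carries a topology can be
   given another one. *)
Record topology_on (T : Type) := TopologyOn {
  opens : set (set T);
  opensT : opens [set: T];
  opensI : forall U V, opens U -> opens V -> opens (U `&` V);
  opens_bigcup : forall D : set (set T), D `<=` opens -> opens (\bigcup_(U in D) U)
}.

Definition with_topology (T : Type) (s : topology_on T) : Type := T.

Section WithTopology.
Variables (T : choiceType) (s : topology_on T).

HB.instance Definition _ := Choice.copy (with_topology s) T.

Lemma opens_bigcup_family (I : Type) (f : I -> set (with_topology s)) :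
  (forall i, opens s (f i)) -> opens s (\bigcup_i f i).
Proof.
move=> fo; have -> : \bigcup_i f i = \bigcup_(U in range f) U.
  by rewrite bigcup_image.
by apply: opens_bigcup => _ [i _ <-].
Qed.

HB.instance Definition _ := @isOpenTopological.Build (with_topology s)
  (opens s) (opensT s) (@opensI _ s) opens_bigcup_family.

End WithTopology.

Definition finer (X : topologicalType) (s : topology_on X) :=
  @open X `<=` opens s.

Definition pot_Fsigma (R : realType) (X Y : topologicalType) (B : set (X * Y)) :=
  borel B /\
  exists (s : topology_on X) (t : topology_on Y),
    [/\ finer s, polish R (with_topology s),
        finer t, polish R (with_topology t)
      & @Fsigma (with_topology s * with_topology t)%type B].

Section Relations.
Variable X : Type.
Implicit Type A : set (X * X).

Definition sym_closure A := A `|` A^-1%relation.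

Definition symmetric_rel A := A = A^-1%relation.

Definition antisymmetric_rel A := A `&` A^-1%relation `<=` diagonal.

Definition irreflexive_rel A := A `&` diagonal = set0.

Definition graph A := irreflexive_rel A /\ symmetric_rel A.

Definition oriented_graph A := irreflexive_rel A /\ antisymmetric_rel A.

(* Only the first n + 1 terms of x matter. *)
Definition acyclic A := ~ exists (n : nat) (x : nat -> X),
  [/\ (2 <= n)%N,
      forall i j, (i <= n)%N -> (j <= n)%N -> x i = x j -> i = j,
      forall i, (i < n)%N -> A (x i, x i.+1)
    & A (x n, x 0%N)].

End Relations.

Definition borel_countable_coloring (X : topologicalType) (A : set (X * X))
    (c : X -> nat) :=
  borel_map c /\ forall x y, A (x, y) -> c x <> c y.

Record relspace := RelSpace {
  space :> topologicalType;
  rel_of : set (space * space)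
}.

Definition embeds (P Q : relspace) :=
  exists f : P -> Q, [/\ injective f, continuous f &
    forall x y, rel_of (f x, f y) <-> rel_of (x, y)].

(* Classes of relspaces are bare predicates: relspace lives in a universe too
   large for the type constructor set. *)
Definition is_basis (C B : relspace -> Prop) :=
  (forall P, B P -> C P) /\ (forall P, C P -> exists2 Q, B Q & embeds Q P).

Definition is_antichain (B : relspace -> Prop) :=
  forall P Q, B P -> B Q -> P <> Q -> ~ embeds P Q /\ ~ embeds Q P.

Definition is_minimum (C : relspace -> Prop) (P : relspace) :=
  C P /\ is_basis C (fun Q => Q = P).

Definition no_borel_countable_coloring (P : relspace) :=
  ~ exists c, borel_countable_coloring (@rel_of P) c.

Definition class_C (R : realType) (P : relspace) : Prop :=
  [/\ polish R P, analytic R (@rel_of P),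
      exists F : set (P * P), [/\ symmetric_rel F, acyclic F,
        pot_Fsigma R F & @rel_of P `<=` F]
    & no_borel_countable_coloring P].

Definition in_pot_Fsigma_acyclic_graph (R : realType) (P : relspace) :=
  exists F : set (P * P),
    [/\ graph F, acyclic F, pot_Fsigma R F & @rel_of P `<=` F].

Definition class_oriented_graphs (R : realType) (P : relspace) : Prop :=
  [/\ polish R P, analytic R (@rel_of P), oriented_graph (@rel_of P),
      in_pot_Fsigma_acyclic_graph R P & no_borel_countable_coloring P].

Definition class_graphs (R : realType) (P : relspace) : Prop :=
  [/\ polish R P, analytic R (@rel_of P), graph (@rel_of P),
      in_pot_Fsigma_acyclic_graph R P & no_borel_countable_coloring P].

(* The binary words of length k, in lexicographic order. *)
Fixpoint binary_words (k : nat) : seq (seq bool) :=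
  if k is k'.+1 then
    [seq false :: w | w <- binary_words k'] ++
    [seq true :: w | w <- binary_words k']
  else [:: [::]].

(* The words of length at most n number 2 ^ n.+1 - 1 > n, so the default value
   of nth is not reached. *)
Definition psi (n : nat) : seq bool :=
  nth [::] (flatten [seq binary_words k | k <- iota 0 n.+1]) n.

Definition s_ (n : nat) : seq bool := psi n ++ nseq (n - size (psi n)) false.

Definition concat (w : seq bool) (g : cantor_space) : cantor_space :=
  fun i => if (i < size w)%N then nth false w i else g (i - size w)%N.

Definition G0 : set (cantor_space * cantor_space) :=
  [set p | exists (n : nat) (g : cantor_space),
    p = (concat (rcons (s_ n) false) g, concat (rcons (s_ n) true) g)].

Definition loop_space : relspace :=
  @RelSpace (discrete_topology 'I_1) [set (ord0, ord0)].

Definition G0_space : relspace := RelSpace G0.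

Definition sG0_space : relspace := RelSpace (sym_closure G0).

Definition three_spaces (P : relspace) : Prop :=
  [\/ P = loop_space, P = G0_space | P = sG0_space].

(* Main.v *)
Require Import Defs.
From mathcomp Require Import all_boot all_order all_algebra.
From mathcomp Require Import all_classical all_reals all_analysis.
From mathcomp Require Import borel_hierarchy lra zify.
Set Implicit Arguments.
Unset Strict Implicit.
Unset Printing Implicit Defensive.
Import Order.TTheory GRing.Theory Num.Theory.
Local Open Scope classical_set_scope.

(* If A meets the diagonal, the one-point loop embeds.  Otherwise A is contained
   in a symmetric acyclic F which is an increasing union of sets F_n closed for
   a complete separable metric finer than the topology of X.  Call a Borel set
   negligible if it is covered by countably many Borel A-independent sets; by
   Lusin separation every analytic A-independent set is negligible.  Call an
   analytic family of maps 2^n -> X, sending the edges of the tree on 2^n given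
   by G0 to A, large if no negligible set meets all of them.  A large family
   contains two maps joined by an A-edge between their values at s_n, and these
   pairs form a large family of maps 2^(n+1) -> X.  Since vertices were given
   pairwise disjoint sets of values, acyclicity of F makes the new maps
   injective and their values at non-adjacent vertices F-unrelated; so countably
   many choices of small closed sets of values, pairwise disjoint and avoiding
   F_n at non-adjacent vertices, cover the family, and one of them leaves it
   large.  In the limit this yields a continuous injective homomorphism f from
   G0 to A such that F (f x, f y) with x <> y implies that (x, y) is in s(G0).
   Applied to A `&` A^-1 when that graph has no Borel countable coloring, f
   embeds s(G0); otherwise A restricted to some colour class of A `&` A^-1 is
   antisymmetric and uncolorable, and f embeds G0. *)

(** * Analytic sets *)

Definition separated (X : topologicalType) := forall x y : X, x <> y ->
  exists O O' : set X, [/\ open O, open O', O x, O' y & O `&` O' = set0].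

(* A continuous image of a Polish space, with the topology and the metric of
   the source replaced by countably many countable covers: whenever the chosen
   cover elements have the finite intersection property, they have a common
   point at which every coordinate map is continuous. *)
Definition sieve (X : topologicalType) (J T : Type) (f : J -> T -> X) :=
  exists (I : countType) (W : I -> nat -> set T),
  (forall i t, exists k, W i k t) /\
  forall a : I -> nat,
    (forall s : seq I, exists t, forall i, i \in s -> W i (a i) t) ->
    exists t, (forall i, W i (a i) t) /\
      forall j (O : set X), open O -> O (f j t) -> exists s : seq I,
        forall t', (forall i, i \in s -> W i (a i) t') -> O (f j t').

(** Analytic subsets of the power X^J, with no topology on X^J itself: [J] is [unit] for sets of
    points, [bool] for relations and [seq bool] for families of maps on words. *)
Definition ana (X : topologicalType) (J : Type) (S : set (J -> X)) :=
  exists (T : Type) (f : J -> T -> X),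
    sieve f /\ forall p, S p <-> exists t, p = fun j => f j t.

Section Sieve.
Variable X : topologicalType.

(** The covers of all factors are pooled. Finitely many covers of one factor are finitely many
    covers of the pool, so limits can be taken coordinatewise. *)
Lemma sieve_prod (K : countType) (J_ T_ : K -> Type)
    (f_ : forall k, J_ k -> T_ k -> X) :
  (forall k, sieve (f_ k)) ->
  sieve (fun (p : {k & J_ k}) (t : forall k, T_ k) =>
           f_ (projT1 p) (projT2 p) (t (projT1 p))).
Proof.
move=> Hf.
pose I_ k := projT1 (cid (Hf k));
  pose W_ k := projT1 (cid (projT2 (cid (Hf k)))).
have HW k : (forall i t, exists n, W_ k i n t) /\
  forall a : I_ k -> nat,
    (forall s : seq (I_ k), exists t, forall i, i \in s -> W_ k i (a i) t) ->
    exists t, (forall i, W_ k i (a i) t) /\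
      forall j (O : set X), open O -> O (f_ k j t) -> exists s : seq (I_ k),
        forall t', (forall i, i \in s -> W_ k i (a i) t') -> O (f_ k j t').
  exact: (projT2 (cid (projT2 (cid (Hf k))))).
exists {k & I_ k},
  (fun i n (t : forall k, T_ k) => W_ (projT1 i) (projT2 i) n (t (projT1 i))).
split=> [[k i] t /=|a fip]; first by case: (HW k) => + _; apply.
have Hlim k : exists t, (forall i, W_ k i (a (existT _ k i)) t) /\
      forall j (O : set X), open O -> O (f_ k j t) -> exists s : seq (I_ k),
        forall t', (forall i, i \in s -> W_ k i (a (existT _ k i)) t') ->
                   O (f_ k j t').
  case: (HW k) => _; apply=> s.
  have [t Ht] := fip [seq existT _ k i | i <- s].
  by exists (t k) => i si; apply: (Ht (existT _ k i)); apply: map_f.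
exists (fun k => projT1 (cid (Hlim k))); split=> [[k i]|[k j] O oO /= tO].
  by case: (projT2 (cid (Hlim k))) => + _; apply.
have [_ /(_ j O oO tO)[s Hs]] := projT2 (cid (Hlim k)).
exists [seq existT _ k i | i <- s] => t' Ht'; apply: Hs => i si.
by apply: (Ht' (existT _ k i)); apply: map_f.
Qed.

(** The second hypothesis makes [P] closed, as seen through two coordinates. A limit outside [P]
    would have neighbourhoods secured by finitely many cover elements, and these still contain a
    point of [P]. *)
Lemma sieve_restrict (J T : Type) (f : J -> T -> X) (P : set T) :
  sieve f ->
  (forall t, ~ P t -> exists j1 j2 (V1 V2 : set X),
     [/\ open V1, open V2, V1 (f j1 t), V2 (f j2 t)
       & forall t', V1 (f j1 t') -> V2 (f j2 t') -> ~ P t']) ->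
  sieve (fun j (t : {t | P t}) => f j (sval t)).
Proof.
move=> [I [W [cov lim]]] cP.
exists I, (fun i n t => W i n (sval t)); split=> [i t|a fip]; first exact: cov.
have [|t [Wt tO]] := lim a.
  by move=> s; have [t Ht] := fip s; exists (sval t).
have Pt : P t.
  apply: contrapT => /cP [j1 [j2 [V1 [V2 [oV1 oV2 Vt1 Vt2 nP]]]]].
  have [s1 Hs1] := tO _ _ oV1 Vt1; have [s2 Hs2] := tO _ _ oV2 Vt2.
  have [[t' Pt'] Ht'] := fip (s1 ++ s2).
  apply: (nP t') => //.
  - by apply: Hs1 => i si; apply: Ht'; rewrite mem_cat si.
  - by apply: Hs2 => i si; apply: Ht'; rewrite mem_cat si orbT.
exists (exist _ t Pt); split=> // j O oO /= /(tO _ _ oO)[s Hs].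
by exists s => t' Ht'; apply: Hs.
Qed.

(** In a Hausdorff space equality of coordinates is a closed condition. Products cut down by such
    equalities yield intersections and preimages below. *)
Lemma sieve_equalizer (J T : Type) (f : J -> T -> X) (E : J -> J -> Prop) :
  separated X -> sieve f ->
  sieve (fun j (t : {t | forall j j', E j j' -> f j t = f j' t}) =>
           f j (sval t)).
Proof.
move=> hX sf; apply: sieve_restrict => // t.
move=> /existsNP [j1 /existsNP [j2 /not_implyP [Ej /hX]]].
move=> [V1 [V2 [oV1 oV2 Vt1 Vt2 V12]]]; exists j1, j2, V1, V2; split=> //.
move=> t' Vt1' Vt2' /(_ _ _ Ej) eqf.
suff : (V1 `&` V2) (f j1 t') by rewrite V12.
by split=> //; rewrite eqf.
Qed.

Lemma sieve_reindex (J J' T : Type) (f : J -> T -> X) (g : J' -> J) :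
  sieve f -> sieve (fun j => f (g j)).
Proof.
move=> [I [W [cov lim]]]; exists I, W; split=> // a /lim[t [Wt tO]].
by exists t; split=> // j O; apply: tO.
Qed.

Lemma sieve_sum (K : countType) (J : Type) (T_ : K -> Type)
    (f_ : forall k, J -> T_ k -> X) :
  (forall k, sieve (f_ k)) ->
  sieve (fun j (t : {k & T_ k}) => f_ (projT1 t) j (projT2 t)).
Proof.
move=> Hf.
pose I_ k := projT1 (cid (Hf k));
  pose W_ k := projT1 (cid (projT2 (cid (Hf k)))).
have HW k : (forall i t, exists n, W_ k i n t) /\
  forall a : I_ k -> nat,
    (forall s : seq (I_ k), exists t, forall i, i \in s -> W_ k i (a i) t) ->
    exists t, (forall i, W_ k i (a i) t) /\
      forall j (O : set X), open O -> O (f_ k j t) -> exists s : seq (I_ k),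
        forall t', (forall i, i \in s -> W_ k i (a i) t') -> O (f_ k j t').
  exact: (projT2 (cid (projT2 (cid (Hf k))))).
(* The index [None] adds the cover by the summands, so that a chosen family lives in a single
   summand. Covers of one summand impose nothing on the others. *)
pose W (i : option {k & I_ k}) (n : nat) (t : {k & T_ k}) : Prop :=
  match i with
  | None => pickle (projT1 t) = n
  | Some i => forall e : projT1 t = projT1 i,
      W_ (projT1 i) (projT2 i) n (eq_rect _ T_ (projT2 t) _ e)
  end.
exists (option {k & I_ k}), W; split.
  move=> [[k i]|] [k' t] /=; last by exists (pickle k').
  have [e|ne] := pselect (k' = k); last by exists 0%N => e; case: (ne e).
  subst k'; case: (HW k) => /(_ i t)[n Wn] _.
  by exists n => e; rewrite (eq_irrelevance e erefl).
move=> a fip.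
have [[k t0] /(_ None (mem_head _ _)) /= ka] := fip [:: None].
have Hp k' : pickle k' = a None -> k' = k.
  by rewrite -ka => /(pcan_inj (@pickleK K)).
case: (HW k) => _ /(_ (fun i => a (Some (existT _ k i))))[s|t [Wt tO]].
  have [[k' t] Ht] := fip (None :: [seq Some (existT _ k i) | i <- s]).
  have e : k' = k := Hp _ (Ht None (mem_head _ _)); subst k'.
  exists t => i si; apply: (Ht (Some (existT _ k i)) _ erefl).
  by rewrite inE/=; apply: (map_f (fun i => Some (existT _ k i))).
exists (existT _ k t); split=> [[[k' i] /= e|//]|].
  by subst k'; exact: Wt.
move=> j O oO /= /(tO _ _ oO)[s Hs].
exists (None :: [seq Some (existT _ k i) | i <- s]) => -[k' t'] Ht'.
have e : k' = k := Hp _ (Ht' None (mem_head _ _)); subst k'.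
apply: Hs => i si; apply: (Ht' (Some (existT _ k i)) _ erefl).
by rewrite inE/=; apply: (map_f (fun i => Some (existT _ k i))).
Qed.

Lemma ana_range (J T : Type) (f : J -> T -> X) (S : set (J -> X)) :
  sieve f -> (forall p, S p <-> exists t, p = fun j => f j t) -> ana S.
Proof. by move=> sf; exists T, f. Qed.

Lemma ana_image (J J' : Type) (g : J' -> J) (S : set (J -> X)) :
  ana S -> ana [set (fun j => p (g j)) | p in S].
Proof.
move=> [T [f [sf Sf]]]; apply: (ana_range (sieve_reindex g sf)) => p; split.
  by move=> [q /Sf[t ->] <-]; exists t.
by move=> [t ->]; exists (fun j => f j t) => //; apply/Sf; exists t.
Qed.

Lemma ana_bigcup (K : countType) (J : Type) (S : K -> set (J -> X)) :
  (forall k, ana (S k)) -> ana (\bigcup_k S k).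
Proof.
move=> aS; pose T_ k := projT1 (cid (aS k)).
pose f_ k := projT1 (cid (projT2 (cid (aS k)))).
have Hf k : sieve (f_ k) /\ forall p, S k p <-> exists t, p = fun j => f_ k j t.
  exact: (projT2 (cid (projT2 (cid (aS k))))).
have Sf k p := (Hf k).2 p.
apply: (ana_range (sieve_sum (fun k => (Hf k).1))) => p; split.
  by move=> [k _ /Sf[t pt]]; exists (existT T_ k t).
by move=> [[k t] ->]; exists k => //; apply/Sf; exists t.
Qed.

(** The parameters are the families of codes, one for each [S k], that all name the same point; [k0]
    selects the code from which this point is read. *)
Lemma ana_bigcap (K : countType) (k0 : K) (J : Type) (S : K -> set (J -> X)) :
  separated X -> (forall k, ana (S k)) -> ana (\bigcap_k S k).
Proof.
move=> hX aS; pose T_ k := projT1 (cid (aS k)).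
pose f_ k := projT1 (cid (projT2 (cid (aS k)))).
have Hf k : sieve (f_ k) /\ forall p, S k p <-> exists t, p = fun j => f_ k j t.
  exact: (projT2 (cid (projT2 (cid (aS k))))).
have Sf k p := (Hf k).2 p.
have := sieve_prod (fun k => (Hf k).1).
move=> /(sieve_equalizer (fun p q : {_ : K & J} => projT2 p = projT2 q) hX).
move=> /(sieve_reindex (fun j : J => existT (fun=> J) k0 j)).
move=> /ana_range; apply=> p; split.
  move=> Sp; have tk k := cid ((Sf k p).1 (Sp k I)).
  have E (p1 p2 : {_ : K & J}) : projT2 p1 = projT2 p2 ->
    f_ (projT1 p1) (projT2 p1) (projT1 (tk (projT1 p1))) =
    f_ (projT1 p2) (projT2 p2) (projT1 (tk (projT1 p2))).
    move=> e.
    have /(congr1 (fun h => h (projT2 p1))) <- := projT2 (tk (projT1 p1)).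
    have /(congr1 (fun h => h (projT2 p2))) <- := projT2 (tk (projT1 p2)).
    by rewrite e.
  exists (exist _ (fun k => projT1 (tk k)) E).
  exact: (projT2 (tk k0)).
move=> [[t E] /= ->] k _; apply/Sf; exists (t k); apply/funext => j.
exact: (E (existT _ k0 j) (existT _ k j)).
Qed.

Lemma ana_setI (J : Type) (S S' : set (J -> X)) :
  separated X -> ana S -> ana S' -> ana (S `&` S').
Proof.
move=> hX aS aS'.
have -> : S `&` S' = \bigcap_(b : bool) (if b then S else S').
  apply/seteqP; split=> [p [Sp Sp'] [] //|p Hp].
  by split; [exact: (Hp true)|exact: (Hp false)].
by apply: (@ana_bigcap bool true) => // -[].
Qed.

Lemma ana_full (J : countType) : ana [set: unit -> X] -> ana [set: J -> X].
Proof.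
move=> [T [f [sf Sf]]].
have := @sieve_prod J (fun=> unit) (fun=> T) (fun=> f) (fun=> sf).
move=> /(sieve_reindex (fun j : J => existT (fun=> unit) j tt)).
move=> /ana_range; apply=> p; split=> // _.
have H j := cid ((Sf (fun=> p j)).1 I).
exists (fun j => projT1 (H j)); apply/funext => j /=.
exact: (congr1 (fun h => h tt) (projT2 (H j))).
Qed.

(** A parameter is a code [t] of a point of [S] together with a code [t0] of a point of the full
    power, subject to the closed conditions that coordinate [j'] of the first is coordinate [g j']
    of the second. *)
Lemma ana_preim (J J' : countType) (g : J' -> J) (S : set (J' -> X)) :
  separated X -> ana [set: unit -> X] ->
  ana S -> ana [set p | S (fun j => p (g j))].
Proof.
move=> hX sX [T [f [sf Sf]]].
have [T0 [f0 [sf0 Sf0]]] := ana_full J sX.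
pose J_ (b : bool) : Type := if b then J else J'.
pose T_ b := if b then T0 else T.
pose f_ b : J_ b -> T_ b -> X := match b with true => f0 | false => f end.
have := @sieve_prod bool J_ T_ f_.
case; first by case.
pose E (p q : {b & J_ b}) := match p, q with
  | existT false j', existT true j => g j' = j | _, _ => False end.
move=> I [W HW]; have {HW I W} : sieve (fun (p : {k & J_ k}) (t : forall k,
  T_ k) =>
           f_ (projT1 p) (projT2 p) (t (projT1 p))) by exists I, W.
move=> /(sieve_equalizer E hX).
move=> /(sieve_reindex (fun j : J => existT J_ true j)).
move=> /ana_range; apply=> p; split.
  move=> /Sf[t pt].
  have [t0 pt0] := (Sf0 p).1 I.
  pose tt b : T_ b := match b with true => t0 | false => t end.
  have Htt p1 p2 : E p1 p2 -> f_ (projT1 p1) (projT2 p1) (tt (projT1 p1)) =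
    f_ (projT1 p2) (projT2 p2) (tt (projT1 p2)).
    case: p1 p2 => -[] j1 [[] j2] //= <-.
    by move/(congr1 (fun h => h j1)): pt => <-; rewrite pt0.
  by exists (exist _ tt Htt).
move=> [[t E'] /= ->]; apply/Sf; exists (t false); apply/funext => j.
exact/esym/(E' (existT J_ false j) (existT J_ true (g j)) erefl).
Qed.

End Sieve.

Section Borel.
Variable X : topologicalType.

Lemma borel_open (O : set X) : open O -> borel O.
Proof. exact: sub_sigma_algebra. Qed.

Lemma borel_setC (B : set X) : borel B -> borel (~` B).
Proof.
move=> bB; rewrite -setTD.
by case: (smallest_sigma_algebra setT (@open X)) => _ + _; apply.
Qed.

Lemma borel_bigcup (B : nat -> set X) :
  (forall n, borel (B n)) -> borel (\bigcup_n B n).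
Proof. by case: (smallest_sigma_algebra setT (@open X)) => _ _; apply. Qed.

Lemma borel_bigcap (B : nat -> set X) :
  (forall n, borel (B n)) -> borel (\bigcap_n B n).
Proof.
move=> bB; rewrite -[X in borel X]setCK setC_bigcap; apply: borel_setC.
by apply: borel_bigcup => n; apply: borel_setC.
Qed.

Lemma borel_set0 : borel (@set0 X).
Proof. by case: (smallest_sigma_algebra setT (@open X)). Qed.

Lemma borel_setT : borel [set: X].
Proof. by apply: borel_open; exact: openT. Qed.

Lemma borel_setI (B C : set X) : borel B -> borel C -> borel (B `&` C).
Proof.
move=> bB bC.
have -> : B `&` C = \bigcap_n (if n is 0%N then B else C).
  apply/seteqP; split => [x [Bx Cx] [|n] _ //|x BC].
  by split; [exact: (BC 0%N)|exact: (BC 1%N)].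
by apply: borel_bigcap => -[].
Qed.

Lemma borel_ind (P : set (set X)) : P `<=` [set A | P (~` A)] ->
  (forall A : nat -> set X, (forall n, P (A n)) -> P (\bigcup_n A n)) ->
  @open X `<=` P -> @borel X `<=` P.
Proof.
move=> PC PU Po; apply: smallest_sub => //; split=> //.
- exact/Po/open0.
- by move=> A /PC; rewrite setTD.
Qed.

End Borel.

(** * Schemes of analytic sets indexed by finite sequences *)

Section Scheme.
Variable X : topologicalType.

Definition ana1 (B : set X) := ana [set p : unit -> X | B (p tt)].

Definition ana2 (A : set (X * X)) :=
  ana [set p : bool -> X | A (p false, p true)].

(** The node at [s] keeps the parameters lying in the elements that [s] selects from the first
    [size s] covers. Finitely many selections along a branch are all made at one node, so nonempty
    nodes give the finite intersection property and the sieve gives the limit. *)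
Lemma ana_scheme (J : Type) (S : set (J -> X)) : ana S ->
  exists Sc : seq nat -> set (J -> X),
  [/\ forall s, ana (Sc s), Sc [::] = S,
      forall s p, Sc s p -> exists n, Sc (rcons s n) p,
      forall s n, Sc (rcons s n) `<=` Sc s
    & forall b : nat -> nat, (forall n, Sc (mkseq b n) !=set0) ->
        exists2 p, S p & forall j (O : set X), open O -> O (p j) ->
          exists n, forall q, Sc (mkseq b n) q -> O (q j)].
Proof.
move=> [T [f [[I [W [cov lim]]] Sf]]].
pose P (s : seq nat) (t : T) :=
  forall i : I, (pickle i < size s)%N -> W i (nth 0%N s (pickle i)) t.
exists (fun s => [set p | exists2 t, P s t & p = fun j => f j t]); split.
- move=> s; exists {t | P s t}, (fun j t => f j (sval t)); split; last first.
    move=> p; split=> [[t Pt ->]|[[t Pt] ->]]; last by exists t.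
    by exists (exist _ t Pt).
  (* Covers already decided by [s] become trivial; [a'] puts the digits of [s] back before the limit
     is taken. *)
  exists I, (fun i n t => if (pickle i < size s)%N then True else W i n (sval
    t)).
  split=> [i t|a fip]; first by case: (_ < _)%N; [exists 0%N|exact: cov].
  pose a' i := if (pickle i < size s)%N then nth 0%N s (pickle i) else a i.
  have [|t [Wt tO]] := lim a'.
    move=> s'; have [[t Pt] Ht] := fip s'; exists t => i /Ht /=.
    by rewrite /a'; case: ifP => // si _; apply: (Pt i).
  have Pt : P s t by move=> i si; have := Wt i; rewrite /a' si.
  exists (exist _ t Pt); split=> /= [i|j O oO /(tO _ _ oO)[s' Hs']].
    by have := Wt i; rewrite /a'; case: ifP.
  exists s' => -[t' Pt'] Ht'; apply: Hs' => i /Ht' /=.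
  by rewrite /a'; case: ifP => // si _; apply: (Pt' i).
- apply/seteqP; split=> [p [t _ ->]|p /Sf[t ->]]; first by apply/Sf; exists t.
  by exists t.
- move=> s p [t Pt ->].
  have [[i ip]|ni] := pselect (exists i : I, pickle i = size s).
    have [n Wn] := cov i t; exists n, t => // i'.
    rewrite size_rcons ltnS leq_eqVlt => /orP[/eqP i's|i's].
      rewrite nth_rcons i's ltnn eqxx.
      by have -> : i' = i by apply: (pcan_inj (@pickleK I)); rewrite ip.
    by rewrite nth_rcons i's; exact: Pt.
  (* No cover has the number [size s], so any digit will do. *)
  exists 0%N, t => // i'.
  rewrite size_rcons ltnS leq_eqVlt => /orP[/eqP i's|i's].
    by exfalso; apply: ni; exists i'.
  by rewrite nth_rcons i's; exact: Pt.
- move=> s n p [t Pt ->]; exists t => // i si.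
  have := Pt i; rewrite size_rcons nth_rcons si; apply.
  exact: ltnW.
- move=> b ne; have [|t [Wt tO]] := lim (fun i => b (pickle i)).
    move=> s; have [p [t Pt _]] := ne (\max_(i <- s) (pickle i).+1).
    exists t => i si; have := Pt i; rewrite size_mkseq => Pi.
    have lti : (pickle i < \max_(i <- s) (pickle i).+1)%N.
      exact: (@leq_bigmax_seq _ s xpredT (fun i => (pickle i).+1)).
    by have := Pi lti; rewrite nth_mkseq.
  exists (fun j => f j t); first by apply/Sf; exists t.
  move=> j O oO /(tO _ _ oO)[s Hs].
  exists (\max_(i <- s) (pickle i).+1) => _ [t' Pt' ->].
  apply: Hs => i si; have := Pt' i; rewrite size_mkseq => Pi.
  have lti : (pickle i < \max_(i <- s) (pickle i).+1)%N.
    exact: (@leq_bigmax_seq _ s xpredT (fun i => (pickle i).+1)).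
  by have := Pi lti; rewrite nth_mkseq.
Qed.

End Scheme.

(** * Separation and fine metrics *)

Section Reflection.
Variable X : topologicalType.

Lemma sub_mkseq (T : Type) (S : seq nat -> set T) (b : nat -> nat) :
  (forall s n, S (rcons s n) `<=` S s) ->
  forall m n, (m <= n)%N -> S (mkseq b n) `<=` S (mkseq b m).
Proof.
move=> dS m n /subnKC <-; elim: (n - m)%N => [|k IH]; first by rewrite addn0.
by rewrite addnS mkseqS => t /dS /IH.
Qed.

(* Lusin's separation argument run simultaneously on the two copies of P and
   on A, so that no analyticity of sections of A over Borel sets is needed. *)
Lemma borel_independent_superset (A : set (X * X)) (P : set X) :
  separated X -> ana2 A -> ana1 P ->
  (forall x y, P x -> P y -> ~ A (x, y)) ->
  exists B, [/\ borel B, P `<=` B & forall x y, B x -> B y -> ~ A (x, y)].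
Proof.
move=> hX aA aP PA.
have [SA [_ SA0 SAS SAd SAl]] := ana_scheme aA.
have [SP [_ SP0 SPS SPd SPl]] := ana_scheme aP.
(* A triple of nodes is good when Borel sets around the two pieces of [P] admit no edge of the piece
   of [A] from the first to the second. *)
pose good (s : seq nat * seq nat * seq nat) := exists BC : set X * set X,
  [/\ borel BC.1 /\ borel BC.2, forall p, SP s.1.1 p -> BC.1 (p tt),
      forall p, SP s.1.2 p -> BC.2 (p tt)
    & forall p, SA s.2 p -> BC.1 (p false) -> ~ BC.2 (p true)].
pose ext (s : seq nat * seq nat * seq nat) (i : nat * nat * nat) :=
  (rcons s.1.1 i.1.1, rcons s.1.2 i.1.2, rcons s.2 i.2).
have good_split s : (forall i, good (ext s i)) -> good s.
  move=> /choice[BC HBC].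
  (* A point of the first set fixes [i], a point of the second then fixes [j], and an edge fixes
     [k]; the pair chosen for [(i, j, k)] excludes that edge. *)
  exists (\bigcup_i \bigcap_j \bigcap_k (BC (i, j, k)).1,
          \bigcap_i \bigcup_j \bigcap_k (BC (i, j, k)).2); split=> /=.
  - split.
      apply: borel_bigcup => i; apply: borel_bigcap => j.
      by apply: borel_bigcap => k; have [[]] := HBC (i, j, k).
    apply: borel_bigcap => i; apply: borel_bigcup => j.
    by apply: borel_bigcap => k; have [[]] := HBC (i, j, k).
  - move=> p /SPS[i pi]; exists i => // j _ k _.
    by have [_ + _ _] := HBC (i, j, k); apply.
  - move=> p /SPS[j pj] i _; exists j => // k _.
    by have [_ _ + _] := HBC (i, j, k); apply.
  - move=> p /SAS[k pk] [i _ Bi] /(_ i I)[j _ Cj].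
    have [_ _ _ /(_ _ pk)] := HBC (i, j, k); apply.
      exact: Bi.
    exact: Cj.
have [|bad] := pselect (good ([::], [::], [::])).
  move=> [[B C] [/= [bB bC] PB PC dBC]]; exists (B `&` C); split.
  - exact: borel_setI.
  - by move=> x Px; split; [apply: (PB (fun=> x))|apply: (PC (fun=> x))];
      rewrite SP0.
  - move=> x y [Bx _] [_ Cy] Axy.
    by apply: (dBC (fun b => if b then y else x)) => //; rewrite SA0.
exfalso.
have /choice[nxt Hnxt] : forall s, exists i, ~ good s -> ~ good (ext s i).
  move=> s; have [gs|ngs] := pselect (good s); first by exists (0%N, 0%N, 0%N).
  have [[i Hi]|nex] := pselect (exists i, ~ good (ext s i)); first by exists i.
  exfalso; apply: ngs; apply: good_split => i.
  by apply: contrapT => ni; apply: nex; exists i.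
pose st := fix st n := if n is m.+1 then ext (st m) (nxt (st m))
  else ([::], [::], [::]).
pose b1 n := (nxt (st n)).1.1; pose b2 n := (nxt (st n)).1.2.
pose b3 n := (nxt (st n)).2.
have stE n : st n = (mkseq b1 n, mkseq b2 n, mkseq b3 n).
  elim: n => //= n IH; rewrite /ext -/st !mkseqS /b1 /b2 /b3.
  by rewrite {1 3 5}IH.
have bst n : ~ good (mkseq b1 n, mkseq b2 n, mkseq b3 n).
  by rewrite -stE; elim: n => //= n IH; exact: Hnxt.
(* An empty node would make its triple good by trivial sets, so all three bad branches have
   limits. *)
have [|p1 P1 p1O] := SPl b1.
  move=> n; apply/set0P/negP => /eqP E; apply: (bst n).
  exists (set0, setT); split => //=.
  - by split; [exact: borel_set0|exact: borel_setT].
  - by rewrite E.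
have [|p2 P2 p2O] := SPl b2.
  move=> n; apply/set0P/negP => /eqP E; apply: (bst n).
  exists (setT, set0); split => //=.
  - by split; [exact: borel_setT|exact: borel_set0].
  - by rewrite E.
  - by move=> p _ _ [].
have [|q Aq qO] := SAl b3.
  move=> n; apply/set0P/negP => /eqP E; apply: (bst n).
  exists (setT, setT); split => //=.
  - by split; exact: borel_setT.
  - by rewrite E.
(* Since [P] is independent, [p1] or [p2] differs from the corresponding endpoint of [q]; disjoint
   neighbourhoods of the two points then make a late triple good. *)
have [e1|/hX[U [V [oU oV Op Oq UV0]]]] := pselect (p1 tt = q false).
  have [e2|/hX[U [V [oU oV Op Oq UV0]]]] := pselect (p2 tt = q true).
    by apply: (PA _ _ P1 P2); rewrite e1 e2.
  have [n Hn] := p2O _ _ oU Op; have [m Hm] := qO _ _ oV Oq.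
  apply: (bst (maxn n m)); exists (setT, U); split => //=.
  - by split; [exact: borel_setT|exact: borel_open].
  - by move=> p /(sub_mkseq SPd (leq_maxl n m)) /Hn.
  - move=> p /(sub_mkseq SAd (leq_maxr n m)) /Hm Vp _ Op'.
    by have : (U `&` V) (p true) by []; rewrite UV0.
have [n Hn] := p1O _ _ oU Op; have [m Hm] := qO _ _ oV Oq.
apply: (bst (maxn n m)); exists (U, setT); split => //=.
- by split; [exact: borel_open|exact: borel_setT].
- by move=> p /(sub_mkseq SPd (leq_maxl n m)) /Hn.
- move=> p /(sub_mkseq SAd (leq_maxr n m)) /Hm Vp Op'.
  by have : (U `&` V) (p false) by []; rewrite UV0.
Qed.

End Reflection.

Section FineMetric.
Variables (R : realType) (X : topologicalType).
Local Open Scope ring_scope.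

Definition mclosed (d : X -> X -> R) (C : set X) :=
  forall x, ~ C x -> exists2 e, 0 < e & forall y, d x y < e -> ~ C y.

(** A finer Polish topology on [X], given by its metric only, so that [X] keeps its own topology.
    Separability takes the form [fm_cover] of countable closed covers with small members. *)
Record fine_metric (d : X -> X -> R) : Prop := FineMetric {
  fm_metric : is_metric d;
  fm_complete : forall u : nat -> X,
    (forall e, 0 < e -> exists N : nat, forall m n : nat,
       (N <= m)%N -> (N <= n)%N -> d (u m) (u n) < e) ->
    exists l, forall e, 0 < e -> exists N : nat, forall n : nat,
       (N <= n)%N -> d l (u n) < e;
  fm_cover : forall e, 0 < e -> exists C : nat -> set X,
    (forall x, exists k, C k x) /\
    forall k, mclosed d (C k) /\ forall x y, C k x -> C k y -> d x y <= e;
  fm_open : forall (O : set X) x, open O -> O x ->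
    exists2 e, 0 < e & forall y, d x y < e -> O y
}.

Lemma inv_succ_lt (e : R) : 0 < e -> exists N : nat, forall n : nat,
  (N <= n)%N -> n.+1%:R^-1 < e.
Proof.
move=> e0; have [N _ HN] := near_infty_natSinv_lt (PosNum e0).
by exists N => n Nn; apply: HN.
Qed.

Variable d : X -> X -> R.
Hypothesis dX : fine_metric d.

Lemma metric_ge0 x y : 0 <= d x y.
Proof.
have [m0 ms mt] := fm_metric dX.
by have := mt x y x; rewrite (ms y x) (m0 x x).2 //; lra.
Qed.

(** Cantor's intersection theorem. *)
Lemma decreasing_closed_point (V : nat -> set X) :
  (forall n, V n !=set0) -> (forall n, V n.+1 `<=` V n) ->
  (forall n, mclosed d (V n)) ->
  (forall n x y, V n x -> V n y -> d x y <= n.+1%:R^-1) ->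
  exists x, forall n, V n x.
Proof.
have [m0 ms mt] := fm_metric dX.
move=> ne dV cV diam; have [u Vu] := choice ne.
have V_sub m n : (m <= n)%N -> V n `<=` V m.
  move=> /subnKC <-; elim: (n - m)%N => [|k IH]; first by rewrite addn0.
  by rewrite addnS => t /dV /IH.
have [|l Hl] := fm_complete dX (u := u).
  move=> e /inv_succ_lt[N HN]; exists N => m n Nm Nn.
  apply: le_lt_trans (HN N _) => //.
  by apply: diam; [apply: V_sub Nm _ _|apply: V_sub Nn _ _].
exists l => n; apply: contrapT => /cV[e e0 He].
have [N HN] := Hl e e0.
apply: (He (u (maxn n N))); first exact/HN/leq_maxr.
exact: V_sub (leq_maxl n N) _ _.
Qed.

Lemma mclosed_setT : mclosed d setT.
Proof. by move=> x []. Qed.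

Lemma mclosed_setI (C D : set X) :
  mclosed d C -> mclosed d D -> mclosed d (C `&` D).
Proof.
move=> cC cD x /not_andP[/cC|/cD][e e0 He]; exists e => // y /He ny [] //.
Qed.

Lemma mclosed_bigcap (I : Type) (P : set I) (C : I -> set X) :
  (forall i, P i -> mclosed d (C i)) -> mclosed d (\bigcap_(i in P) C i).
Proof.
move=> cC x /existsNP[i /not_implyP[Pi /(cC _ Pi)[e e0 He]]].
by exists e => // y /He nC /(_ i Pi).
Qed.

(** The closed covers at the scales 1/(n+1) form a sieve: Cantor's theorem gives the common point,
    and a cover element of small diameter around it fits into any open set containing it. *)
Lemma ana_mclosed (C : set X) : mclosed d C -> ana1 C.
Proof.
move=> cC; exists {x | C x}, (fun (_ : unit) t => sval t); split; last first.
  move=> p; split=> [Cp|[[x Cx] ->]//]; exists (exist _ (p tt) Cp).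
  by apply/funext => -[].
have inv0 n : 0 < n.+1%:R^-1 :> R by rewrite invr_gt0.
have [W HW] := choice (fun n => fm_cover dX (inv0 n)).
exists nat, (fun n k t => W n k (sval t)); split=> [n [x Cx]|a fip] /=.
  exact: (HW n).1.
pose V n := C `&` \bigcap_(i in [set i | (i <= n)%N]) W i (a i).
have [n|n x [Cx Wx]|n|n x y [_ /(_ n)Wx] [_ /(_ n)Wy]|x Vx] :=
    decreasing_closed_point (V := V).
- have [[x Cx] Wx] := fip (iota 0 n.+1); exists x; split=> // i /= ni.
  by apply: Wx; rewrite mem_iota add0n ltnS.
- by split=> // i /= ni; apply: Wx; rewrite /= (leq_trans ni).
- apply: mclosed_setI => //; apply: mclosed_bigcap => i _.
  by have [_ /(_ (a i))[]] := HW i.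
- have [_ /(_ (a n))[_ ]] := HW n; by apply; [apply: Wx => /=|apply: Wy => /=].
exists (exist _ x (Vx 0%N).1); split=> [i|_ O oO /(fm_open dX oO)[e e0 He]] /=.
  by have [_ /(_ i)] := Vx i; apply; rewrite /=.
have [n Hn] := inv_succ_lt e0.
exists [:: n] => -[y Cy] /(_ n (mem_head _ _)) /= Wy; apply: He.
apply: le_lt_trans (Hn n (leqnn n)).
have [_ /(_ (a n))[_ ]] := HW n; apply => //.
by have [_ /(_ n)] := Vx n; apply; rewrite /=.
Qed.

Lemma mclosed_closed (C : set X) : open (~` C) -> mclosed d C.
Proof. by move=> oC x /(fm_open dX oC)[e e0 He]; exists e. Qed.

Lemma ana_set0 (J : Type) : ana (@set0 (J -> X)).
Proof.
exists False, (fun _ (t : False) => match t with end); split;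
  last by split=> [//|[]].
by exists nat, (fun _ _ _ => True); split=> [_ []|a /(_ [::])[[]]].
Qed.

(** An open set is the union of the cover elements, over all scales, that it contains. *)
Lemma ana_open (O : set X) : open O -> ana1 O.
Proof.
have [m0 ms mt] := fm_metric dX.
move=> oO; have inv0 n : 0 < n.+1%:R^-1 :> R by rewrite invr_gt0.
have [W HW] := choice (fun n => fm_cover dX (inv0 n)).
pose S (nk : nat * nat) : set (unit -> X) := [set p |
  W nk.1 nk.2 `<=` O /\ W nk.1 nk.2 (p tt)].
have := @ana_bigcup X (nat * nat)%type unit S.
have -> : \bigcup_k S k = [set p | O (p tt)].
  apply/seteqP; split=> [p [k _ [WO Wp]]|p /= Op]; first exact: WO.
  have [e e0 He] := fm_open dX oO Op; have [n Hn] := inv_succ_lt e0.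
  have [/(_ (p tt))[k Wk] /(_ k)[_ dW]] := HW n.
  exists (n, k) => //; split=> //= y Wy; apply: He.
  by apply: le_lt_trans (Hn n (leqnn n)); exact: dW.
apply=> -[n k]; rewrite /S /=.
have [WO|nWO] := pselect (W n k `<=` O).
  have -> : [set p : unit -> X | W n k `<=` O /\ W n k (p tt)] =
    [set p | W n k (p tt)] by apply/seteqP; split=> // p [].
  by apply: ana_mclosed; have [_ /(_ k)[]] := HW n.
have -> : [set p : unit -> X | W n k `<=` O /\ W n k (p tt)] = set0.
  by apply/seteqP; split=> // p [].
exact: ana_set0.
Qed.

Lemma ana_borel (B : set X) : separated X -> borel B -> ana1 B.
Proof.
(* The induction carries the complement along, which makes the complement step trivial. *)
move=> hX bB; suff [] : ana1 B /\ ana1 (~` B) by [].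
move: B bB; apply: borel_ind => [A [aA aCA]|A aA|O oO].
- by split=> //; rewrite setCK.
- split; last first.
    rewrite setC_bigcup /ana1.
    have -> : [set p : unit -> X | (\bigcap_n ~` A n) (p tt)] =
      \bigcap_n [set p | (~` A n) (p tt)] by [].
    by apply: (@ana_bigcap _ nat 0%N) => // n; case: (aA n).
  rewrite /ana1.
  have -> : [set p : unit -> X | (\bigcup_n A n) (p tt)] =
      \bigcup_n [set p | (A n) (p tt)] by [].
  by apply: (@ana_bigcup _ nat) => n; case: (aA n).
- split; first exact: ana_open.
  by apply: ana_mclosed; apply: mclosed_closed; rewrite setCK.
Qed.

End FineMetric.

(** * Words, trees and acyclic relations *)

Section Words.

Lemma mem_binary_words k w : (w \in binary_words k) = (size w == k).
Proof.
elim: k w => [|k IH] [|b w] //=; rewrite mem_cat.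
  by apply/negbTE/norP; split; apply/mapP => -[].
apply/orP/idP => [[] /mapP[v] |]; rewrite ?IH.
- by move=> vk [_ ->].
- by move=> vk [_ ->].
rewrite eqSS -IH; case: b => wk; [right|left]; exact: map_f.
Qed.

Definition words_below m := flatten [seq binary_words k | k <- iota 0 m].

Lemma words_belowS m : words_below m.+1 = words_below m ++ binary_words m.
Proof. by rewrite /words_below -addn1 iotaD map_cat flatten_cat /= cats0. Qed.

Lemma size_words_below m : (m <= size (words_below m))%N.
Proof.
elim: m => // m IH; rewrite words_belowS size_cat.
have : nseq m false \in binary_words m by rewrite mem_binary_words size_nseq.
by case: (binary_words m) => //= *; rewrite addnS ltnS (leq_trans IH) ?leq_addr.
Qed.

Lemma nth_words_below m n i : (m <= n)%N -> (i < size (words_below m))%N ->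
  nth [::] (words_below n) i = nth [::] (words_below m) i.
Proof.
move=> /subnKC <- im; elim: (n - m)%N => [|k IH]; first by rewrite addn0.
rewrite addnS words_belowS nth_cat IH; case: ifP => //.
suff le : (size (words_below m) <= size (words_below (m + k)))%N.
  by rewrite (leq_trans im le).
elim: (k) => [|j]; first by rewrite addn0.
by rewrite addnS words_belowS size_cat => /leq_trans; apply; exact: leq_addr.
Qed.

Lemma size_psi n : (size (psi n) <= n)%N.
Proof.
rewrite /psi -/(words_below n.+1).
have : nth [::] (words_below n.+1) n \in words_below n.+1.
  exact/mem_nth/size_words_below.
move=> /flatten_mapP[k]; rewrite mem_iota mem_binary_words => + /eqP ->.
by rewrite add0n ltnS.
Qed.

Lemma psi_surj t : exists n, psi n = t.
Proof.
pose k := size t; have tk : t \in words_below k.+1.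
  by rewrite words_belowS mem_cat mem_binary_words eqxx orbT.
have ik : (index t (words_below k.+1) < size (words_below k.+1))%N.
  by rewrite index_mem.
exists (index t (words_below k.+1)); rewrite /psi -/(words_below _).
set i := index _ _ in ik *; have := nth_index [::] tk; rewrite -/i => <-.
case: (leqP k i) => ki; first exact: nth_words_below.
by apply/esym/nth_words_below; [exact: ltnW|exact: size_words_below].
Qed.

Lemma size_s_ n : size (s_ n) = n.
Proof. by rewrite /s_ size_cat size_nseq subnKC // size_psi. Qed.

(** Density of the words [s_ n], on which the category argument against Borel colorings rests. *)
Lemma s_dense t : exists n z, s_ n = t ++ z.
Proof.
by have [n pn] := psi_surj t; exists n, (nseq (n - size t) false);
  rewrite /s_ pn.
Qed.

(** The finite trace of [G0]: a tree on the words of each length. *)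
Definition word_edge (u v : seq bool) := exists k t,
  u = rcons (s_ k) false ++ t /\ v = rcons (s_ k) true ++ t.

Definition word_adj u v := word_edge u v \/ word_edge v u.

Lemma word_edge_size u v : word_edge u v -> size u = size v.
Proof. by move=> [k [t [-> ->]]]; rewrite !size_cat !size_rcons. Qed.

Lemma word_edge_rcons u v b : word_edge u v ->
  word_edge (rcons u b) (rcons v b).
Proof. by move=> [k [t [-> ->]]]; exists k, (rcons t b);
  rewrite !rcons_cat. Qed.

Lemma word_edge_s n : word_edge (rcons (s_ n) false) (rcons (s_ n) true).
Proof. by exists n, [::]; rewrite !cats0. Qed.

(** The recursion behind the construction: the tree at length n+1 is two copies of the tree at
    length n, joined by the single edge between the two extensions of [s_ n]. *)
Lemma word_edgeP u v a b : word_edge (rcons u a) (rcons v b) ->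
  (word_edge u v /\ a = b) \/
  [/\ u = s_ (size u), v = s_ (size u), a = false & b = true].
Proof.
move=> [k [t]]; elim/last_ind: t => [|t c _].
  rewrite !cats0 => -[/rcons_inj[-> ->] /rcons_inj[-> ->]]; right.
  by rewrite size_s_.
rewrite -!rcons_cat => -[/rcons_inj[-> ->] /rcons_inj[-> ->]]; left.
by split=> //; exists k, t.
Qed.

Lemma word_adj_sym u v : word_adj u v -> word_adj v u.
Proof. by case; [right|left]. Qed.

Lemma word_adj_size u v : word_adj u v -> size u = size v.
Proof. by case=> /word_edge_size. Qed.

Lemma path_word_size u p w :
  path (fun u v => `[<word_adj u v>]) u p -> w \in u :: p -> size w = size u.
Proof.
elim: p u => [|v p IH] u /=; first by rewrite inE => _ /eqP ->.
move=> /andP[/asboolP/word_adj_size uv pv]; rewrite inE => /orP[/eqP -> //|].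
by move=> /(IH _ pv) ->.
Qed.

(** By induction on the length, passing through [s_ n], whose two extensions are adjacent;
    [shortenP] then removes repetitions. *)
Lemma word_path u v : size u = size v -> exists p,
  [/\ path (fun u v => `[<word_adj u v>]) u p, last u p = v & uniq (u :: p)].
Proof.
move=> uv; suff [p pp pv] : exists2 p,
    path (fun u v => `[<word_adj u v>]) u p & last u p = v.
  by case: (shortenP pp) pv => p' pp' up' _ pv; exists p'.
have [n un] : exists n, size u = n by exists (size u).
elim: n u v un uv => [|n IH] u v un.
  by rewrite un => /esym/size0nil ->; exists [::]; rewrite ?(size0nil un).
case: (lastP u) un => // {}u a; rewrite size_rcons => -[un].
case: (lastP v) => [|{}v b]; rewrite ?size_rcons // => -[vn].
have lift p c w : path (fun u v => `[<word_adj u v>]) w p ->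
    path (fun u v => `[<word_adj u v>]) (rcons w c) [seq rcons x c | x <- p].
  apply: (@homo_path _ _ (rcons^~ c)) => x y /asboolP xy; apply/asboolP.
  by case: xy => /(word_edge_rcons c); [left|right].
have [|p pp pl] := IH u (s_ n) un; first by rewrite size_s_.
have [|q qq ql] := IH (s_ n) v (size_s_ n); first by rewrite size_s_ -vn.
case: (eqVneq a b) => [<-|ab].
  exists [seq rcons x a | x <- p ++ q]; last first.
    by rewrite (last_map (rcons^~ a)) last_cat pl ql.
  by apply: lift; rewrite cat_path pp pl.
exists ([seq rcons x a | x <- p] ++
        rcons (s_ n) b :: [seq rcons x b | x <- q]); last first.
  by rewrite last_cat /= (last_map (rcons^~ b)) ql.
rewrite cat_path lift //= (last_map (rcons^~ a)) pl lift // andbT;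
  apply/asboolP.
by case: a b ab => -[] // _; [right|left]; exact: word_edge_s.
Qed.

End Words.

(** * Images of the word trees in an acyclic relation *)

Section Acyclic.
Variables (X : choiceType) (F : set (X * X)).
Hypotheses (symF : symmetric_rel F) (acF : acyclic F).

Let Fr (x y : X) := `[<F (x, y)>].

Lemma symF_E x y : F (x, y) -> F (y, x).
Proof. by move=> Fxy; rewrite symF. Qed.

Lemma acyclic_path x p : path Fr x p -> uniq (x :: p) -> (2 <= size p)%N ->
  ~ F (last x p, x).
Proof.
move=> pp up sp Fl; apply: acF; exists (size p), (nth x (x :: p)); split=> //.
- by move=> i j ip jp /eqP; rewrite nth_uniq // => /eqP.
- by move=> i ip; move/pathP: pp => /(_ x i ip) /asboolP.
- by rewrite nth_last.
Qed.

Definition word_hom n (phi : seq bool -> X) :=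
  (forall u v, size u = n -> word_edge u v -> F (phi u, phi v)) /\
  (forall u v, size u = n -> size v = n -> phi u = phi v -> u = v).

Lemma word_hom_path n phi u p : word_hom n phi -> size u = n ->
  path (fun u v => `[<word_adj u v>]) u p -> path Fr (phi u) (map phi p).
Proof.
move=> [hF _]; elim: p u => //= v p IH u un /andP[/asboolP uv pv].
have vn : size v = n by rewrite -(word_adj_size uv).
rewrite IH // andbT; apply/asboolP.
by case: uv => [/hF|/hF/symF_E]; apply.
Qed.

Lemma word_hom_uniq n phi u p : word_hom n phi -> size u = n ->
  path (fun u v => `[<word_adj u v>]) u p -> uniq (u :: p) ->
  uniq (map phi (u :: p)).
Proof.
move=> [_ hI] un pp up; rewrite map_inj_in_uniq // => v w vp wp; apply: hI.
  by rewrite (path_word_size pp vp).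
by rewrite (path_word_size pp wp).
Qed.

(** The tree path between non-adjacent words has at least two edges, so an [F]-edge between the end
    values would close its image into a cycle. *)
Lemma word_hom_nonadjacent n phi u v : word_hom n phi ->
  size u = n -> size v = n -> u <> v -> ~ word_adj u v -> ~ F (phi u, phi v).
Proof.
move=> hphi un vn uv nadj Fuv.
have [|p [pp pl up]] := @word_path u v; first by rewrite un.
apply: (acyclic_path (word_hom_path hphi un pp) (word_hom_uniq hphi un pp up)).
  rewrite size_map; case: p pp pl {up} => [//|w [|//]] /=.
  by rewrite andbT => /asboolP + wv; rewrite wv.
by rewrite last_map pl; exact: symF_E.
Qed.

(** Take the first word on the tree path from [s_ n] to [u] at which the two maps meet. Going out
    along [phi0], back along [phi1] and closing with the edge between the values at [s_ n] gives a
    cycle of [F]. *)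
Lemma word_hom_double n phi0 phi1 : word_hom n phi0 -> word_hom n phi1 ->
  (forall u v, size u = n -> size v = n -> u <> v -> phi0 u <> phi1 v) ->
  F (phi0 (s_ n), phi1 (s_ n)) -> phi0 (s_ n) <> phi1 (s_ n) ->
  forall u, size u = n -> phi0 u <> phi1 u.
Proof.
move=> h0 h1 dis Fs ns u un; have sn := size_s_ n.
have [|p [pp pl up]] := @word_path (s_ n) u; first by rewrite sn.
suff H w : w \in s_ n :: p -> phi0 w <> phi1 w by apply: H;
  rewrite -pl mem_last.
elim/last_ind: p {u un pl} pp up w => [|p w IH] pp up v.
  by rewrite inE => /eqP ->.
have [pp' pw] : path (fun u v => `[<word_adj u v>]) (s_ n) p /\
    word_adj (last (s_ n) p) w.
  by move: pp; rewrite rcons_path => /andP[? /asboolP].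
have {}IH x : x \in s_ n :: p -> phi0 x <> phi1 x.
  by apply: IH => //; move: up; rewrite -rcons_cons rcons_uniq => /andP[].
rewrite -rcons_cons mem_rcons inE => /orP[/eqP ->|/IH//] e.
have P0 := word_hom_path h0 sn pp; have P1 := word_hom_path h1 sn pp.
have U0 := word_hom_uniq h0 sn pp up; have U1 := word_hom_uniq h1 sn pp up.
have sz x : x \in s_ n :: rcons p w -> size x = n.
  by move=> /(path_word_size pp) ->.
(* The common value at [w] is listed once, at the end of the outgoing half; the returning half stops
   short of [w]. *)
have := @acyclic_path (phi0 (s_ n))
  (map phi0 (rcons p w) ++ rev (map phi1 (s_ n :: p))).
case.
- rewrite cat_path P0 last_map last_rcons e /=.
  have -> : phi1 w = last (phi1 (s_ n)) (map phi1 (rcons p w)).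
    by rewrite last_map last_rcons.
  have -> : phi1 (s_ n) :: map phi1 p = belast (phi1 (s_ n)) (map phi1 (rcons p
    w)).
    by rewrite map_rcons belast_rcons.
  rewrite rev_path; congr is_true: P1; apply: eq_path => x y.
  by apply/asboolP/asboolP; exact: symF_E.
- rewrite -cat_cons cat_uniq rev_uniq; apply/and3P; split.
  + exact: U0.
  + apply/hasPn => x; rewrite mem_rev => /mapP[b bp ->]; apply/negP.
    rewrite -map_cons => /mapP[a ap].
    have bs : size b = n.
      by apply: sz; rewrite -rcons_cons mem_rcons inE bp orbT.
    have [->|ab] := eqVneq a b; first by move/esym; exact: IH.
    by move/esym; apply: dis => //; [exact: sz|exact/eqP].
  + by move: U1; rewrite -rcons_cons map_rcons rcons_uniq => /andP[].
- by rewrite size_cat size_rev !size_map size_rcons /= addSn addnS.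
- by rewrite last_cat rev_cons last_rcons; exact: symF_E.
Qed.

End Acyclic.

(** * Prefixes and the edges of G0 *)

Section Cylinders.
Variable V : uniformType.
Hypothesis dV : forall v : V, open [set v].

Lemma nbhs_cylinder (x : prod_topology (fun _ : nat => V)) n :
  nbhs x [set y : prod_topology (fun _ : nat => V) | mkseq y n = mkseq x n].
Proof.
elim: n => [|n IH]; first by apply: filterS filterT.
have Hn : nbhs x [set y : prod_topology (fun _ : nat => V) | y n = x n].
  apply: (@proj_continuous _ (fun _ : nat => V) n x [set x n]).
  exact: open_nbhs_nbhs.
by apply: filterS2 IH Hn => y /= yx yn; rewrite !mkseqS yx yn.
Qed.

Lemma cylinder_nbhs (x : prod_topology (fun _ : nat => V)) U :
  nbhs x U -> exists n, forall y, mkseq y n = mkseq x n -> U y.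
Proof.
pose cyl n := [set y : prod_topology (fun _ : nat =>
  V) | mkseq y n = mkseq x n].
pose G := filter_from setT cyl.
have mk_le (y : nat -> V) m n : (m <= n)%N -> mkseq y n = mkseq x n ->
    mkseq y m = mkseq x m.
  move=> mn e; apply: (@eq_from_nth _ (x 0%N)); rewrite !size_mkseq // => i im.
  have := congr1 (fun s => nth (x 0%N) s i) e.
  by rewrite !nth_mkseq // (leq_trans im).
have FG : Filter G.
  apply: filter_from_filter; first by exists 0%N.
  move=> m n _ _; exists (maxn m n) => // y yx.
  by split; apply: mk_le yx; rewrite ?leq_maxl ?leq_maxr.
have : G --> x.
  apply/(@pointwise_cvgP nat V) => t W /nbhs_singleton Wt.
  exists t.+1 => // y /= yx; suff -> : y t = x t by [].
  have := congr1 (fun s => nth (x 0%N) s t) yx.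
  by rewrite !nth_mkseq.
by move=> Gx /Gx[n _ Hn]; exists n.
Qed.

End Cylinders.

Section G0.

Lemma bool_open (b : bool) : open [set b].
Proof. exact: discrete_open. Qed.

Lemma mkseq_inj_nth (T : Type) (x y : nat -> T) n :
  mkseq x n = mkseq y n <-> forall i, (i < n)%N -> x i = y i.
Proof.
split=> [e i lt|e].
  have := congr1 (fun s => nth (x 0%N) s i) e.
  by rewrite !nth_mkseq.
apply: (@eq_from_nth _ (x 0%N)); rewrite !size_mkseq // => i lt.
by rewrite !nth_mkseq // e.
Qed.

Lemma mkseq_concat w g n : mkseq (concat w g) (size w + n) = w ++ mkseq g n.
Proof.
apply: (@eq_from_nth _ false);
  rewrite size_mkseq ?size_cat ?size_mkseq // => i lt.
rewrite nth_mkseq // nth_cat /concat; case: ltnP => // wi.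
by rewrite nth_mkseq // ltn_subLR.
Qed.

Definition G0_edge k (x y : cantor_space) :=
  [/\ mkseq x k = s_ k, x k = false, y k = true &
      forall i, i <> k -> x i = y i].

Lemma G0P x y : G0 (x, y) <-> exists k, G0_edge k x y.
Proof.
split=> [[k [g [-> ->]]]|[k [xs xk yk xy]]].
  exists k; split=> [|||i ik].
  - have := mkseq_concat (rcons (s_ k) false) g 0.
    rewrite size_rcons size_s_ addn0 cats0 mkseqS => /eqP.
    by rewrite eqseq_rcons => /andP[/eqP].
  - by rewrite /concat size_rcons size_s_ ltnS leqnn nth_rcons size_s_ ltnn
    eqxx.
  - by rewrite /concat size_rcons size_s_ ltnS leqnn nth_rcons size_s_ ltnn
    eqxx.
  - rewrite /concat !size_rcons size_s_ ltnS !nth_rcons size_s_.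
    by case: (ltngtP i k) => // /ik.
exists k, (fun i => x (i + k.+1)%N); congr pair; apply/funext => i.
  rewrite /concat size_rcons size_s_; case: ltnP => [|ki];
    last by rewrite subnK.
  rewrite ltnS leq_eqVlt nth_rcons size_s_ => /orP[/eqP ->|ik].
    by rewrite ltnn eqxx.
  by rewrite ik -xs nth_mkseq.
rewrite /concat size_rcons size_s_; case: ltnP => [|ki]; last first.
  by rewrite subnK // xy //; lia.
rewrite ltnS leq_eqVlt nth_rcons size_s_ => /orP[/eqP ->|ik].
  by rewrite ltnn eqxx.
by rewrite ik -xs nth_mkseq // xy //; lia.
Qed.

Lemma word_edge_mkseq (x y : nat -> bool) m :
  word_edge (mkseq x m) (mkseq y m) -> exists k,
  [/\ (k < m)%N, mkseq x k = s_ k, x k = false, y k = true &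
      forall i, (i < m)%N -> i <> k -> x i = y i].
Proof.
move=> [k [t [ex ey]]].
have sm : m = (k.+1 + size t)%N.
  by have := congr1 size ex; rewrite size_mkseq size_cat size_rcons size_s_.
have nx i : (i < m)%N -> x i = nth false (rcons (s_ k) false ++ t) i.
  by move=> im; rewrite -ex nth_mkseq.
have ny i : (i < m)%N -> y i = nth false (rcons (s_ k) true ++ t) i.
  by move=> im; rewrite -ey nth_mkseq.
have km : (k < m)%N by rewrite sm; lia.
exists k; split=> //.
- apply: (@eq_from_nth _ false); rewrite size_mkseq ?size_s_ // => i ik.
  rewrite nth_mkseq // nx ?(ltn_trans ik) //.
  by rewrite nth_cat size_rcons size_s_ ltnS (ltnW ik) nth_rcons size_s_ ik.
- by rewrite nx // nth_cat size_rcons size_s_ ltnSn nth_rcons size_s_ ltnn eqxx.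
- by rewrite ny // nth_cat size_rcons size_s_ ltnSn nth_rcons size_s_ ltnn eqxx.
- move=> i im ik; rewrite nx // ny // !nth_cat !size_rcons size_s_.
  by rewrite !nth_rcons size_s_ ltnS; case: (ltngtP i k) => // /ik.
Qed.

(** Adjacent prefixes differ at one coordinate only. Once the length exceeds that coordinate it is
    the same for all longer prefixes, so the limits differ only there. *)
Lemma sym_closure_G0_limit (x y : cantor_space) N : x <> y ->
  (forall m, (N <= m)%N -> mkseq x m <> mkseq y m ->
     word_adj (mkseq x m) (mkseq y m)) ->
  sym_closure G0 (x, y).
Proof.
move=> xy adj; have [i0 xi] : exists i, x i <> y i.
  by apply: contrapT => H; apply: xy; apply/funext => i; apply: contrapT => ?;
     apply: H; exists i.
have [L adjL] : exists L, forall m, (L <= m)%N ->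
    word_adj (mkseq x m) (mkseq y m).
  exists (maxn N i0.+1) => m; rewrite geq_max => /andP[Nm im]; apply: adj => //.
  by move/mkseq_inj_nth => /(_ i0 im).
move=> {xy adj i0 xi}.
wlog [k [kL xs xk yk _]] : x y adjL / exists k,
    [/\ (k < L)%N, mkseq x k = s_ k, x k = false, y k = true &
      forall i, (i < L)%N -> i <> k -> x i = y i].
  move=> H; have [/word_edge_mkseq|/word_edge_mkseq] := adjL L (leqnn L).
    exact: H.
  move=> /H; case; last by left.
  - by move=> m /adjL/word_adj_sym.
  - by right.
left; apply/G0P; exists k; split=> // i ik.
have [Lm mi] : (L <= maxn L i.+1)%N /\ (i < maxn L i.+1)%N.
  by rewrite leq_maxl leq_maxr.
have [] := adjL _ Lm => /word_edge_mkseq[k' [_ _ xk' yk' E]].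
  have kk' : k = k'.
    apply: contrapT => ne; have := E k (leq_trans kL Lm) ne.
    by rewrite xk yk.
  by apply: E; rewrite -?kk'.
have kk' : k = k'.
  apply: contrapT => ne; have := E k (leq_trans kL Lm) ne.
  by rewrite xk yk.
by apply/esym/E; rewrite -?kk'.
Qed.

End G0.

(** * Construction of an injective homomorphism *)

Section Finite.

Lemma eventually_all (T : eqType) (s : seq T) (P : T -> nat -> Prop) :
  (forall x, x \in s -> exists N, forall m, (N <= m)%N -> P x m) ->
  exists N, forall m, (N <= m)%N -> forall x, x \in s -> P x m.
Proof.
elim: s => [|y s IH] H; first by exists 0%N.
have [|N HN] := IH; first by move=> x xs; apply: H; rewrite inE xs orbT.
have [M HM] := H y (mem_head _ _).
exists (maxn M N) => m; rewrite geq_max => /andP[Mm Nm] x.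
by rewrite inE => /orP[/eqP ->|]; [exact: HM|exact: HN].
Qed.

(** Storing finitely many choices in a [seq nat] keeps the set of all possible choices countable, as
    the sigma-ideal argument of [stage_step] requires. *)
Lemma code_choice (I : countType) (s : seq I) (P : I -> nat -> Prop) :
  (forall i, i \in s -> exists k, P i k) ->
  exists c : seq nat, forall i, i \in s -> P i (nth 0%N c (pickle i)).
Proof.
move=> H.
have /choice[g Hg] : forall i, exists k, i \in s -> P i k.
  move=> i; have [/H[k Pk]|/negP ni] := boolP (i \in s); first by exists k.
  by exists 0%N.
exists (mkseq (fun k => if unpickle k is Some i then g i else 0%N)
         (\max_(i <- s) (pickle i).+1)) => i si.
have lti : (pickle i < \max_(i <- s) (pickle i).+1)%N.
  exact: (@leq_bigmax_seq _ s xpredT (fun i => (pickle i).+1)).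
by rewrite nth_mkseq // pickleK; exact: Hg.
Qed.

End Finite.

Section Construction.
Variables (R : realType) (X : topologicalType) (d : X -> X -> R).
Hypotheses (dX : fine_metric d) (hX : separated X).
Variables (A F : set (X * X)) (Fn : nat -> set (X * X)).
Hypotheses (aA : ana2 A) (irrA : forall x, ~ A (x, x)) (AF : A `<=` F).
Hypotheses (symF : symmetric_rel F) (acF : acyclic F).
Hypothesis FnF : forall n, Fn n `<=` F.
Hypothesis closedFn : forall n x y, ~ Fn n (x, y) -> exists2 e, (0 < e)%R &
  forall a b, (d x a < e)%R -> (d y b < e)%R -> ~ Fn n (a, b).

Definition independent_family (C : nat -> set X) :=
  forall i, borel (C i) /\ forall x y, C i x -> C i y -> ~ A (x, y).

Hypothesis uncovered : forall C, independent_family C ->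
  exists x, forall i, ~ C i x.

Variable SA : seq nat -> set (bool -> X).
Hypotheses (aSA : forall s, ana (SA s))
  (SA0 : SA [::] = [set p | A (p false, p true)])
  (SAS : forall s p, SA s p -> exists n, SA (rcons s n) p)
  (SAd : forall s n, SA (rcons s n) `<=` SA s)
  (SAl : forall b : nat -> nat, (forall n, SA (mkseq b n) !=set0) ->
        exists2 p, A (p false, p true) & forall j (O : set X),
          open O -> O (p j) ->
          exists n, forall q, SA (mkseq b n) q -> O (q j)).

(* A stage of the construction: a set of possible values for each word and,
   for each edge between words, a node of the scheme of A. *)
Definition stage := ((seq bool -> set X) * (seq bool -> seq bool ->
  seq nat))%type.

(** Only the values at words of length [n] are constrained; the other values are arbitrary. *)
Definition configs n (D : stage) : set (seq bool -> X) := [set phi |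
  (forall u, size u = n -> D.1 u (phi u)) /\
  (forall u v, size u = n -> word_edge u v ->
     SA (D.2 u v) (fun b : bool => phi (if b then v else u)))].

(* The sets of configurations that are not large form a sigma-ideal. *)
Definition large n (K : set (seq bool -> X)) := forall C,
  independent_family C ->
  exists2 phi, K phi & forall u, size u = n -> forall i, ~ C i (phi u).

Definition stage_inv n (D : stage) :=
  [/\ forall u, mclosed d (D.1 u),
      forall u v, size u = n -> size v = n -> u <> v -> D.1 u `&` D.1 v = set0
    & large n (configs n D)].

Lemma SA_sub s : SA s `<=` SA [::].
Proof. by elim/last_ind: s => // s n IH p /SAd/IH. Qed.

Lemma SA_edge s p : SA s p -> A (p false, p true).
Proof. by move=> /SA_sub; rewrite SA0. Qed.

Lemma ana1_setI (B C : set X) : ana1 B -> ana1 C -> ana1 (B `&` C).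
Proof. exact: (ana_setI hX). Qed.

Lemma ana_setT : ana [set: unit -> X].
Proof. exact: (ana_mclosed dX (@mclosed_setT R X d)). Qed.

(** A projection of a countable intersection of analytic conditions. This is the set to which
    separation is applied in [large_double]. *)
Lemma ana_config_values n D C : stage_inv n D -> independent_family C ->
  ana1 [set x | exists2 phi, configs n D phi &
    (forall u, size u = n -> forall i, ~ C i (phi u)) /\ phi (s_ n) = x].
Proof.
move=> [cD _ _] iC.
pose S (uv : seq bool * seq bool) : set (seq bool -> X) :=
  [set phi | size uv.1 = n -> (D.1 uv.1 `&` ~` \bigcup_i C i) (phi uv.1)] `&`
  [set phi | size uv.1 = n /\ word_edge uv.1 uv.2 ->
     SA (D.2 uv.1 uv.2) (fun b : bool => phi (if b then uv.2 else uv.1))].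
have aT := ana_full (seq bool : countType) ana_setT.
have aimp (P : Prop) (S' : set (seq bool -> X)) : ana S' ->
    ana [set phi | P -> S' phi].
  move=> aS'; have [p|np] := pselect P.
    by have -> : [set phi | P -> S' phi] = S';
      [apply/seteqP; split=> phi //= /(_ p)|].
  by have -> : [set phi | P -> S' phi] = setT;
    [apply/seteqP; split=> phi //= _ /np|].
have aS : ana (\bigcap_uv S uv).
  apply: (@ana_bigcap _ (seq bool * seq bool)%type ([::], [::])) => //.
  move=> [u v]; apply: (ana_setI hX); apply: aimp => /=.
    have := @ana_preim X (seq bool) unit (fun=> u)
      [set p | (D.1 u `&` ~` \bigcup_i C i) (p tt)] hX ana_setT.
    apply; apply: ana1_setI; first exact: (ana_mclosed dX).
    apply: (ana_borel dX) => //; apply: borel_setC; apply: borel_bigcup => i.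
    exact: (iC i).1.
  exact: (@ana_preim X (seq bool) bool (fun b : bool => if b then v else u)
            (SA (D.2 u v)) hX ana_setT).
have := ana_image (fun _ : unit => s_ n) aS.
rewrite /ana1; congr ana; apply/seteqP; split=> p /=.
  move=> [phi Sphi <-]; exists phi; split=> //.
  - by move=> u un; have [/= /(_ un)[]] := Sphi (u, [::]) I.
  - by move=> u v un uv; have [_ /= ] := Sphi (u, v) I; apply.
  - move=> u un i Ci; have [/= /(_ un)[_ + _]] := Sphi (u, [::]) I.
    by apply; exists i.
move=> [phi [phiU phiE] [phiC phis]]; exists phi; last first.
  by apply/funext => -[].
move=> [u v] _; split=> /= [un|[un uv]]; last exact: phiE.
by split; [exact: phiU|move=> [i _]; exact: phiC].
Qed.

Definition wbody (w : seq bool) := take (size w).-1 w.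

Lemma wbody_rcons u a : wbody (rcons u a) = u.
Proof. by rewrite /wbody size_rcons /= -cats1 take_size_cat. Qed.

Lemma size_rcons_inv n (w : seq bool) : size w = n.+1 ->
  exists u a, w = rcons u a /\ size u = n.
Proof.
case: (lastP w) => // u a; rewrite size_rcons => -[un].
by exists u, a.
Qed.

(** Both copies inherit the sets and nodes of [D]; pairs with different last letters get the root,
    where membership in [A] is the only demand. *)
Definition double_stage (D : stage) : stage :=
  (fun w => D.1 (wbody w),
   fun w w' => if last false w == last false w' then D.2 (wbody w) (wbody w')
               else [::]).

(** If no two configurations avoiding [C] had an [A]-edge between their values at [s_ n], these
    values would form an independent analytic set, hence lie in a Borel independent [B]. Adding [B]
    to [C] contradicts the largeness of the old stage. *)
Lemma large_double n D : stage_inv n D ->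
  large n.+1 (configs n.+1 (double_stage D)).
Proof.
move=> invD C iC; apply: contrapT => nC.
have aP := ana_config_values invD iC.
set P := (X in ana1 X) in aP.
have [x y [phi Kphi [phiC <-]] [psi Kpsi [psiC <-]] Axy|B [bB PB BA]] :=
    borel_independent_superset hX aA aP.
  apply: nC; exists (fun w => (if last false w then psi else phi) (wbody w)).
    split=> [w /size_rcons_inv[u [a [-> un]]]|w w'] /=.
      rewrite wbody_rcons last_rcons.
      by case: a; [exact: Kpsi.1|exact: Kphi.1].
    move=> /size_rcons_inv[u [a [-> un]]].
    case: (lastP w') => [/word_edge_size|v b E].
      by rewrite size_rcons.
    rewrite !last_rcons !wbody_rcons.
    have -> : (fun b0 : bool =>
        (if last false (if b0 then rcons v b else rcons u a) then psi else phi)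
        (wbody (if b0 then rcons v b else rcons u a))) =
      fun b0 : bool => if b0 then (if b then psi else phi) v
        else (if a then psi else phi) u.
      by apply/funext => -[]; rewrite last_rcons wbody_rcons.
    have [[uv <-]|[us vs -> ->]] := word_edgeP E.
      rewrite eqxx; case: a {E}.
        by have := Kpsi.2 u v un uv; congr (SA _); apply/funext => -[].
      by have := Kphi.2 u v un uv; congr (SA _); apply/funext => -[].
    by rewrite un in us vs; rewrite /= SA0 /= us vs.
  move=> w /size_rcons_inv[u [a [-> un]]] i.
  by rewrite wbody_rcons last_rcons; case: a; [exact: psiC|exact: phiC].
have [|phi Kphi phiC] := (let: And3 _ _ L := invD in L)
    (fun k => if k is i.+1 then C i else B).
  by case.
apply: (phiC (s_ n) (size_s_ n) 0%N); apply: PB; exists phi => //; split=> //.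
by move=> u un i; exact: phiC u un i.+1.
Qed.

(** The first two clauses make the sets along a branch shrink to a point, the third bars [Fn n]
    between non-adjacent words, and the last two make the nodes of a fixed edge follow a branch of
    the scheme from its root. *)
Definition stage_ref n (D D' : stage) :=
  [/\ forall u a, size u = n -> D'.1 (rcons u a) `<=` D.1 u,
      forall w, size w = n.+1 -> forall x y, D'.1 w x -> D'.1 w y ->
        (d x y <= n.+1%:R^-1)%R,
      forall w w', size w = n.+1 -> size w' = n.+1 -> w <> w' ->
        ~ word_adj w w' -> forall x y, D'.1 w x -> D'.1 w' y -> ~ Fn n (x, y),
      forall u v a, size u = n -> word_edge u v ->
        exists k, D'.2 (rcons u a) (rcons v a) = rcons (D.2 u v) k
    & D'.2 (rcons (s_ n) false) (rcons (s_ n) true) = [::]].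

(** Here acyclicity gives injectivity: disjoint sets of values separate different bodies, and
    [word_hom_double] separates the two extensions of one body, starting from irreflexivity of [A]
    at [s_ n]. *)
Lemma double_hom n D Phi : stage_inv n D ->
  configs n.+1 (double_stage D) Phi -> word_hom F n.+1 Phi.
Proof.
move=> [_ disD _] [KU KE].
have hF u v : size u = n.+1 -> word_edge u v -> A (Phi u, Phi v).
  by move=> un uv; exact: (SA_edge (KE u v un uv)).
have DU u a : size u = n -> D.1 u (Phi (rcons u a)).
  by move=> un; have := KU (rcons u a); rewrite size_rcons un /= wbody_rcons;
    apply.
have dis u v a b : size u = n -> size v = n -> u <> v ->
    Phi (rcons u a) <> Phi (rcons v b).
  move=> un vn uv e; have : (D.1 u `&` D.1 v) (Phi (rcons u a)).
    by split; [exact: DU|rewrite e; exact: DU].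
  by rewrite disD.
have hom a : word_hom F n (fun u => Phi (rcons u a)).
  split=> [u v un uv|u v un vn].
    apply: AF; apply: hF; first by rewrite size_rcons un.
    exact: word_edge_rcons.
  by apply: contraPP => uv; exact: dis.
have As : A (Phi (rcons (s_ n) false), Phi (rcons (s_ n) true)).
  by apply: hF (word_edge_s n); rewrite size_rcons size_s_.
have neq := word_hom_double symF acF (hom false) (hom true)
  (fun u v un vn uv => dis u v false true un vn uv) (AF As).
have {}neq u : size u = n -> Phi (rcons u false) <> Phi (rcons u true).
  by apply: neq => e; move: As; rewrite e; exact: irrA.
split=> [u v un uv|w w' /size_rcons_inv[u [a [-> un]]]].
  by apply: AF; exact: hF.
move=> /size_rcons_inv[v [b [-> vn]]] e.
have [uv|uv] := pselect (u = v); last by have := dis _ _ a b un vn uv.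
subst v; case: a b e => -[] // e; first by case: (neq u un).
by case: (neq u un).
Qed.

(** A code consists of a scale, a cover element for each word and a digit for each edge. If every
    good code left a set that is not large, the countably many witnesses could be pooled; a
    configuration of the doubled stage avoiding the pool still obeys some good code, a
    contradiction. *)
Lemma stage_step n D : stage_inv n D ->
  exists D', stage_inv n.+1 D' /\ stage_ref n D D'.
Proof.
move=> invD; have [cD disD _] := invD; have LD := large_double invD.
have [m0 ms mt] := fm_metric dX.
have inv0 k : (0 < k.+1%:R^-1 :> R)%R by rewrite invr_gt0.
have [W HW] := choice (fun k => fm_cover dX (inv0 k)).
pose code := (nat * seq nat * seq nat)%type.
pose D' (i : code) : stage :=
  (fun w => D.1 (wbody w) `&` W i.1.1 (nth 0%N i.1.2 (pickle w)),
   fun w w' => if last false w == last false w'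
     then rcons (D.2 (wbody w) (wbody w')) (nth 0%N i.2 (pickle (w, w')))
     else [::]).
pose good (i : code) := [/\ (n <= i.1.1)%N,
  forall w w', size w = n.+1 -> size w' = n.+1 -> w <> w' ->
    (D' i).1 w `&` (D' i).1 w' = set0
  & forall w w', size w = n.+1 -> size w' = n.+1 -> w <> w' ->
        ~ word_adj w w' -> forall x y, (D' i).1 w x -> (D' i).1 w' y ->
        ~ Fn n (x, y)].
have [[i gi Li]|nL] := pselect (exists2 i,
  good i & large n.+1 (configs n.+1 (D' i))).
  have [ni dis nF] := gi; exists (D' i); split; split=> //.
  - move=> w; apply: mclosed_setI; first exact: cD.
    by have [_ /(_ (nth 0%N i.1.2 (pickle w)))[]] := HW i.1.1.
  - by move=> u a un x [] /=; rewrite wbody_rcons.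
  - move=> w wn x y [_ Wx] [_ Wy].
    have [_ /(_ (nth 0%N i.1.2 (pickle w)))[_ /(_ _ _ Wx Wy) le]] := HW i.1.1.
    by apply: le_trans le _; rewrite lef_pV2 ?posrE ?ltr0n // ler_nat ltnS.
  - move=> u v a un uv; rewrite /= !last_rcons eqxx !wbody_rcons.
    by eexists.
  - by rewrite /= !last_rcons.
exfalso.
have /choice[C HC] : forall i, exists C, independent_family C /\
    (good i -> forall phi, configs n.+1 (D' i) phi ->
       exists u j, size u = n.+1 /\ C j (phi u)).
  move=> i; have [gi|ngi] := pselect (good i); last first.
    exists (fun=> set0); split=> // _; split=> [|x y []//].
    exact: borel_set0.
  have /existsNP[C /not_implyP[iC nC]] : ~ large n.+1 (configs n.+1 (D' i)).
    by move=> Li; apply: nL; exists i.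
  exists C; split=> // _ phi Kphi; apply: contrapT => H; apply: nC.
  exists phi => // u un j Cj; apply: H.
  by exists u, j.
pose C' k := if @unpickle (code * nat)%type k is Some ij then C ij.1 ij.2
  else set0.
have [|Phi KPhi PhiC] := LD C'.
  move=> k; rewrite /C'; case: unpickle => [[i j]|]; last first.
    by split=> [|x y []//]; exact: borel_set0.
  exact: (HC i).1.
have homPhi := double_hom invD KPhi.
pose ws := binary_words n.+1; pose wws := [seq (w, w') | w <- ws, w' <- ws].
have wsP w : size w = n.+1 -> w \in ws by rewrite mem_binary_words => ->.
have wwsP w w' : size w = n.+1 -> size w' = n.+1 -> (w, w') \in wws.
  by move=> /wsP ? /wsP ?; apply: (allpairs_f pair).
(* At a fine enough scale closeness to [Phi] suffices: its values at distinct words differ, those at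
   non-adjacent words are not [F]-related, and [Fn n] is a closed subset of [F]. *)
have [|N HN] := @eventually_all _ wws (fun ww m => ww.1 <> ww.2 ->
    forall a b, (d (Phi ww.1) a <= m.+1%:R^-1)%R ->
                (d (Phi ww.2) b <= m.+1%:R^-1)%R ->
    a <> b /\ (~ word_adj ww.1 ww.2 -> ~ Fn n (a, b))).
  move=> _ /allpairsP[[w w'] /= [wn w'n ->]] /=.
  move: wn w'n; rewrite !mem_binary_words => /eqP wn /eqP w'n.
  have [->|ww'] := eqVneq w w'; first by exists 0%N.
  have Pne : Phi w <> Phi w' by move=> /(homPhi.2 _ _ wn w'n)/eqP; exact/negP.
  have [N1 HN1] : exists N, forall m, (N <= m)%N -> forall a b,
      (d (Phi w) a <= m.+1%:R^-1)%R -> (d (Phi w') b <= m.+1%:R^-1)%R -> a <> b.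
    have e0 : (0 < d (Phi w) (Phi w') / 2)%R.
      rewrite divr_gt0 // lt_neqAle (metric_ge0 dX) andbT.
      by apply/eqP => /esym/m0.
    have [N HN] := inv_succ_lt e0; exists N => m /HN lt a b wa wb ab.
    rewrite -ab in wb; have := mt (Phi w) a (Phi w').
    rewrite (ms a (Phi w')); move: wa wb lt; move: (m.+1%:R^-1)%R => q; lra.
  have [adj|nadj] := pselect (word_adj w w').
    by exists N1 => m Nm _ a b wa wb; split=> // ; exact: (HN1 m).
  have [e e0 He] : exists2 e, (0 < e)%R & forall a b,
      (d (Phi w) a < e)%R -> (d (Phi w') b < e)%R -> ~ Fn n (a, b).
    apply: closedFn => /FnF; apply: (word_hom_nonadjacent symF acF homPhi) =>
      //.
    exact/eqP.
  have [N2 HN2] := inv_succ_lt e0.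
  exists (maxn N1 N2) => m; rewrite geq_max => /andP[Nm1 Nm2] _ a b wa wb.
  split; first exact: (HN1 m).
  by move=> _; apply: He; apply: le_lt_trans (HN2 m Nm2).
pose m := maxn N n.
have [c Hc] : exists c : seq nat, forall w, w \in ws ->
    W m (nth 0%N c (pickle w)) (Phi w).
  by apply: (@code_choice _ ws (fun w k => W m k (Phi w))) => w _;
    exact: (HW m).1.
pose EP (ww : seq bool * seq bool) k := word_edge ww.1 ww.2 ->
  SA (rcons ((double_stage D).2 ww.1 ww.2) k)
     (fun b : bool => Phi (if b then ww.2 else ww.1)).
have [l Hl] : exists l : seq nat, forall ww, ww \in wws ->
    EP ww (nth 0%N l (pickle ww)).
  apply: (@code_choice _ wws EP) => ww.
  move=> /allpairsP[[v v'] /= [vn _ ->]]; rewrite /EP.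
  have [E|nE] := pselect (word_edge v v'); last by exists 0%N.
  have vs : size v = n.+1 by apply/eqP; rewrite -mem_binary_words.
  by have /SAS[k Hk] := KPhi.2 v v' vs E; exists k.
have WP w x : size w = n.+1 -> (D' (m, c, l)).1 w x ->
    (d (Phi w) x <= m.+1%:R^-1)%R.
  move=> wn [_ Wx]; have [_ /(_ (nth 0%N c (pickle w)))[_]] := HW m.
  by apply => //; exact/Hc/wsP.
have gi : good (m, c, l).
  split=> /=; first exact: leq_maxr.
    move=> w w' wn w'n ww'; apply/seteqP; split=> // x [Dx Dx'].
    have [/(_ erefl)] := HN m (leq_maxl _ _) (w, w') (wwsP _ _ wn w'n) ww' x x
      (WP _ _ wn Dx) (WP _ _ w'n Dx'); by [].
  move=> w w' wn w'n ww' nadj x y Dx Dy.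
  have [_] := HN m (leq_maxl _ _) (w, w') (wwsP _ _ wn w'n) ww' x y
      (WP _ _ wn Dx) (WP _ _ w'n Dy).
  exact.
have [_ /(_ gi Phi)] := HC (m, c, l).
case.
  split=> [w wn|w w' wn E] /=.
    by split; [exact: KPhi.1|exact/Hc/wsP].
  have w'n : size w' = n.+1 by rewrite -(word_edge_size E).
  have := Hl (w, w') (wwsP _ _ wn w'n) E => /=.
  (* For the new edge the node of [D'] is the root, so the digit chosen for that edge is dropped
     again. *)
  case: ifP => // _ /SAd.
  exact.
move=> u [j [un Cu]]; apply: (PhiC u un (pickle ((m, c, l), j))).
by rewrite /C' pickleK.
Qed.

Hypothesis FnS : forall m n, (m <= n)%N -> Fn m `<=` Fn n.
Hypothesis F_Fn : F `<=` \bigcup_n Fn n.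

Definition stage0 : stage := (fun=> setT, fun _ _ => [::]).

(** At length 0 a configuration is a single point, and largeness is the hypothesis [uncovered]. *)
Lemma stage0_inv : stage_inv 0 stage0.
Proof.
split=> [u|u v /size0nil -> /size0nil -> //|C iC].
  exact: mclosed_setT.
have [x xC] := uncovered iC; exists (fun=> x); last by move=> u _ i; exact: xC.
split=> // u v /size0nil -> [k [t [/(congr1 size)]]].
by rewrite size_cat size_rcons.
Qed.

Lemma injective_homomorphism : exists f : cantor_space -> X,
  [/\ injective f, continuous f, forall x y, G0 (x, y) -> A (f x, f y)
    & forall x y, x <> y -> F (f x, f y) -> sym_closure G0 (x, y)].
Proof.
have /choice[nxt Hnxt] : forall p : nat * stage, exists D', stage_inv p.1 p.2 ->
    stage_inv p.1.+1 D' /\ stage_ref p.1 p.2 D'.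
  move=> [n D]; have [/stage_step[D' HD']|nD] := pselect (stage_inv n D).
    by exists D'.
  by exists D => /nD.
pose D_ := fix D_ n := if n is m.+1 then nxt (m, D_ m) else stage0.
have inv n : stage_inv n (D_ n).
  elim: n => [|n IH]; first exact: stage0_inv.
  exact: (Hnxt (n, D_ n) IH).1.
have ref n : stage_ref n (D_ n) (D_ n.+1) by exact: (Hnxt (n, D_ n) (inv n)).2.
pose V (x : nat -> bool) n := (D_ n).1 (mkseq x n).
have VS x n : V x n.+1 `<=` V x n.
  have [VS _ _ _ _] := ref n.
  by rewrite {1}/V mkseqS; apply: VS; rewrite size_mkseq.
have diam x n y z : V x n.+1 y -> V x n.+1 z -> (d y z <= n.+1%:R^-1)%R.
  by have [_ dm _ _ _] := ref n; apply: dm; rewrite size_mkseq.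
have ne n : configs n (D_ n) !=set0.
  have [_ _ /(_ (fun=> set0))[|phi Kphi _]] := inv n; last by exists phi.
  by move=> i; split=> [|x y []//]; exact: borel_set0.
(* Cantor's theorem is applied from stage 1 on, where the diameter bounds begin. *)
have /choice[f Hf] : forall x : cantor_space, exists y, forall n, V x n y.
  move=> x; have [n|n|n|n y z|y Hy] :=
      decreasing_closed_point dX (V := fun n => V x n.+1).
  - by have [phi [KU _]] := ne n.+1; eexists; apply: KU; rewrite size_mkseq.
  - exact: VS.
  - by have [cD _ _] := inv n.+1; exact: cD.
  - exact: diam.
  - by exists y => n; apply: VS.
have near x (O : set X) : open O -> O (f x) -> exists N, forall n, (N <= n)%N ->
    V x n `<=` O.
  move=> oO /(fm_open dX oO)[e e0 He]; have [N HN] := inv_succ_lt e0.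
  exists N.+1 => -[//|n] Nn y Vy; apply: He; apply: le_lt_trans (HN n Nn).
  exact: diam (Hf x n.+1) Vy.
exists f; split.
- move=> x y fxy; apply/funext => i; apply: contrapT => xyi.
  have [_ dis _] := inv i.+1.
  have : ((D_ i.+1).1 (mkseq x i.+1) `&` (D_ i.+1).1 (mkseq y i.+1)) (f x).
    by split; [exact: Hf x i.+1|rewrite fxy; exact: Hf y i.+1].
  rewrite dis ?size_mkseq // => /mkseq_inj_nth/(_ i (ltnSn i)).
  exact: xyi.
- move=> x U; rewrite nbhsE => -[G [oG Gfx] GU].
  have [N HN] := near x G oG Gfx.
  apply: filterS (@nbhs_cylinder bool bool_open x N) => y /= yx.
  apply: GU; apply: (HN N) => //.
  by rewrite /V -yx; exact: Hf.
- move=> _ _ [k [g [-> ->]]]; set x := concat _ _; set y := concat _ _.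
  have xE n : mkseq x (k.+1 + n) = rcons (s_ k) false ++ mkseq g n.
    by have := mkseq_concat (rcons (s_ k) false) g n;
      rewrite size_rcons size_s_.
  have yE n : mkseq y (k.+1 + n) = rcons (s_ k) true ++ mkseq g n.
    by have := mkseq_concat (rcons (s_ k) true) g n; rewrite size_rcons size_s_.
  have xyE n : word_edge (mkseq x (k.+1 + n)) (mkseq y (k.+1 + n)).
    by rewrite xE yE; exists k, (mkseq g n).
  (* The edge appears at stage k+1 with the root as its node and gains one digit at each stage; its
     nodes form a branch [b] of the scheme. *)
  pose lab n := (D_ (k.+1 + n)).2 (mkseq x (k.+1 + n)) (mkseq y (k.+1 + n)).
  have labS n : exists j, lab n.+1 = rcons (lab n) j.
    have [_ _ _ + _] := ref (k.+1 + n)%N.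
    move=> /(_ _ _ (g n) (size_mkseq _ _) (xyE n)).
    by rewrite /lab !xE !yE !mkseqS !rcons_cat addnS.
  have lab0 : lab 0%N = [::].
    have [_ _ _ _] := ref k.
    by rewrite /lab xE yE !cats0 addn0.
  have /choice[b Hb] := labS.
  have labE n : lab n = mkseq b n.
    by elim: n => [|n IH]; [exact: lab0|rewrite mkseqS Hb IH].
  have KA n : exists2 phi, SA (mkseq b n) (fun c : bool => phi c) &
      V x (k.+1 + n) (phi false) /\ V y (k.+1 + n) (phi true).
    have [phi [KU KE]] := ne (k.+1 + n)%N.
    exists (fun c => phi (if c then mkseq y (k.+1 + n) else mkseq x (k.+1 +
      n))).
      by have := KE _ _ (size_mkseq _ _) (xyE n); rewrite -/(lab n) labE.
    by split; apply: KU; rewrite size_mkseq.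
  have [|p Ap pO] := SAl (b := b).
    by move=> n; have [phi Kphi _] := KA n; exists phi.
  (* The configurations of [KA] lie in the nodes of [b], which tend to [p], and in the sets that
     shrink to [f x] and [f y]; so the limits agree. *)
  have eqp (c : bool) : p c = f (if c then y else x).
    apply: contrapT => /hX[G [W [oG oW Gp Wf GW]]].
    have [n1 Hn1] := pO c G oG Gp.
    have [N HN] := near _ W oW Wf.
    have [phi SAphi Vphi] := KA (maxn n1 N).
    have : (G `&` W) (phi c).
      split; first exact/Hn1/(sub_mkseq SAd (leq_maxl n1 N)).
      apply: (HN (k.+1 + maxn n1 N)%N).
        exact: leq_trans (leq_maxr n1 N) (leq_addl _ _).
      by case: c {Gp Wf Hn1 HN}; [exact: Vphi.2|exact: Vphi.1].
    by rewrite GW.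
  by rewrite (eqp false) (eqp true) in Ap.
- move=> x y xy /F_Fn[M _ FM].
  (* The pair lies in every [Fn m] with [m] at least [M], so from length M+1 on distinct prefixes
     must be adjacent. *)
  apply: (@sym_closure_G0_limit _ _ M.+1 xy) => -[//|m] Mm neq.
  apply: contrapT => nadj.
  have [_ _ nF _ _] := ref m.
  apply: (nF _ _ (size_mkseq _ _) (size_mkseq _ _) neq nadj _ _
    (Hf x m.+1) (Hf y m.+1)).
  exact: FnS FM.
Qed.

End Construction.

(** * G0 has no Borel countable coloring *)

Section Baire.
Implicit Types (B : set cantor_space) (w t v : seq bool).

Definition cylinder w := [set x : cantor_space | mkseq x (size w) = w].

(* B is comeager in the cylinder of w; a dense open set is given by the words
   whose cylinder it contains. *)
Definition comeager_on B w := exists Q : nat -> seq bool -> Prop,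
  (forall n t, exists t', Q n (w ++ t ++ t')) /\
  forall x, cylinder w x -> (forall n, exists m, Q n (mkseq x m)) -> B x.

Lemma take_mkseq (T : Type) (x : nat -> T) m j : (j <= m)%N ->
  take j (mkseq x m) = mkseq x j.
Proof.
by move=> jm; rewrite /mkseq -map_take take_iota; have /minn_idPl -> := jm.
Qed.

Lemma comeager_on_sub B B' w : B `<=` B' -> comeager_on B w -> comeager_on B' w.
Proof.
by move=> BB' [Q [dQ QB]]; exists Q; split=> // x wx Qx; exact/BB'/QB.
Qed.

Lemma cylinder_cat w t : cylinder (w ++ t) `<=` cylinder w.
Proof.
move=> x; rewrite /cylinder /= size_cat => e; apply: (@eq_from_nth _ false).
  by rewrite size_mkseq.
move=> i; rewrite size_mkseq => iw; rewrite nth_mkseq //.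
have := congr1 (fun s => nth false s i) e; rewrite nth_cat iw nth_mkseq //.
exact: leq_trans iw (leq_addr _ _).
Qed.

Lemma comeager_on_cat B w t : comeager_on B w -> comeager_on B (w ++ t).
Proof.
move=> [Q [dQ QB]]; exists Q; split=> [n t'|x /cylinder_cat]; last exact: QB.
by have [t'' Ht''] := dQ n (t ++ t'); exists t'';
  rewrite -catA catA -catA in Ht'' *;
  move: Ht''; rewrite !catA.
Qed.

Lemma comeager_on_bigcap (B : nat -> set cantor_space) w :
  (forall n, comeager_on (B n) w) -> comeager_on (\bigcap_n B n) w.
Proof.
move=> /choice[Q HQ].
exists (fun k v => if @unpickle (nat * nat)%type k is Some ij then Q ij.1 ij.2 v
                   else True); split.
  move=> k t; case: unpickle => [[i j]|]; last by exists [::].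
  exact: (HQ i).1.
move=> x wx Qx i _; apply: (HQ i).2 => // j.
by have := Qx (pickle (i, j)); rewrite pickleK.
Qed.

(** The dense open sets of the various cylinders are glued along the shortest prefix at which [B] is
    comeager. A branch has only one such prefix, so all the conditions it meets come from one family
    [Q]. *)
Lemma comeager_on_dense B w : (forall t, exists t',
  comeager_on B (w ++ t ++ t')) ->
  comeager_on B w.
Proof.
move=> dB.
have /choice[Q HQ] : forall v, exists Q : nat -> seq bool -> Prop,
  comeager_on B v ->
    (forall n t, exists t', Q n (v ++ t ++ t')) /\
    forall x, cylinder v x -> (forall n, exists m, Q n (mkseq x m)) -> B x.
  move=> v; have [[Q HQ]|nv] := pselect (comeager_on B v); first by exists Q.
  by exists (fun _ _ => True) => /nv.
pose first_on v k := comeager_on B (take k v) /\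
  forall j, (j < k)%N -> ~ comeager_on B (take j v).
pose G n v := exists k, [/\ (k <= size v)%N, first_on v k & Q (take k v) n v].
exists G; split=> [n t|x wx Gx].
  have [t' Bt'] := dB t; set v := w ++ t ++ t' in Bt'.
  have [|k /asboolP Bk kmin] := @ex_minnP (fun k =>
    `[<comeager_on B (take k v)>]).
    by exists (size v); apply/asboolP; rewrite take_size.
  have kv : (k <= size v)%N by apply: kmin; apply/asboolP; rewrite take_size.
  have [t'' Qt''] := (HQ _ Bk).1 n (drop k v).
  exists (t' ++ t''); rewrite catA catA -(catA w) -/v.
  exists k; split.
  - by rewrite size_cat (leq_trans kv) ?leq_addr.
  - split; first by rewrite takel_cat.
    move=> j jk; rewrite takel_cat; last by rewrite (leq_trans (ltnW jk)).
    by move=> Bj; have := kmin j (asboolT Bj); rewrite leqNgt jk.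
  - by rewrite takel_cat //; rewrite catA cat_take_drop in Qt''.
have [m0 [k [km [Bk kmin] _]]] := Gx 0%N; rewrite size_mkseq in km.
rewrite take_mkseq // in Bk.
apply: (HQ _ Bk).2 => [|n]; first by rewrite /cylinder /= size_mkseq.
have [m [k' [k'm [Bk' k'min] Qk']]] := Gx n; exists m.
rewrite size_mkseq in k'm; rewrite take_mkseq // in Bk';
  rewrite take_mkseq // in Qk'.
suff -> : k = k' by [].
apply/eqP; rewrite eqn_leq leqNgt [X in _ && X]leqNgt; apply/andP; split.
  by apply/negP => kk; apply: (kmin _ kk);
    rewrite take_mkseq // (leq_trans (ltnW kk)).
by apply/negP => kk; apply: (k'min _ kk);
  rewrite take_mkseq // (leq_trans (ltnW kk)).
Qed.

(** A weak Baire property, by induction on Borel sets. For a union, either some member is comeager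
    in a cylinder below [w], or each complement is so in densely many cylinders and
    [comeager_on_dense] applies. *)
Lemma borel_comeager_or B w : borel B ->
  exists t, comeager_on B (w ++ t) \/ comeager_on (~` B) (w ++ t).
Proof.
have trivial_on B' v : cylinder v `<=` B' -> comeager_on B' v.
  move=> vB; exists (fun _ _ => True); split=> [n t|x /vB //].
  by exists [::].
move=> bB; move: B bB w; apply: borel_ind => [B HB w|B HB w|G oG w] /=.
- by rewrite setCK; have [t [Bt|Bt]] := HB w; exists t; [right|left].
- have [[i [t Bt]]|nB] := pselect (exists i t, comeager_on (B i) (w ++ t)).
    by exists t; left; apply: comeager_on_sub Bt; exact: bigcup_sup.
  exists [::]; right; rewrite cats0 setC_bigcup.
  apply: comeager_on_bigcap => i; apply: comeager_on_dense => t.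
  have [t' [Bt'|Bt']] := HB i (w ++ t).
    by exfalso; apply: nB; exists i, (t ++ t'); rewrite catA.
  by exists t'; rewrite catA.
- have [[x [wx Gx]]|nG] := pselect (exists x, cylinder w x /\ G x).
    have [n Hn] := @cylinder_nbhs bool x G (open_nbhs_nbhs (conj oG Gx)).
    have xn : (size w <= maxn n (size w))%N by exact: leq_maxr.
    exists (drop (size w) (mkseq x (maxn n (size w)))); left; apply: trivial_on.
    have tw : take (size w) (mkseq x (maxn n (size w))) = w.
      by rewrite take_mkseq.
    rewrite -{1}tw cat_take_drop => y; rewrite /cylinder /= size_mkseq => e;
      apply: Hn.
    by rewrite -(take_mkseq y (leq_maxl n (size w))) e take_mkseq ?leq_maxl.
  by exists [::]; right; rewrite cats0; apply: trivial_on => x wx Gx;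
    apply: nG; exists x.
Qed.

(** The Baire category theorem: the word is extended into each dense set in turn, and the appended
    [false] forces its length to grow. *)
Lemma comeager_on_nonempty B : comeager_on B [::] -> B !=set0.
Proof.
move=> [Q [dQ QB]].
have /choice[e He] : forall nv : nat * seq bool, exists t, Q nv.1 (nv.2 ++ t).
  by move=> [n v]; have [t] := dQ n v; exists t.
pose v := fix v n := if n is m.+1 then rcons (v m ++ e (m,
  v m)) false else [::].
have vS n : exists t, v n.+1 = v n ++ t.
  by exists (rcons (e (n, v n)) false); rewrite /= rcons_cat.
have v_le m n : (m <= n)%N -> exists t, v n = v m ++ t.
  move=> /subnKC <-; elim: (n - m)%N => [|k [t IH]].
    by exists [::]; rewrite addn0 cats0.
  by rewrite addnS; have [t' ->] := vS (m + k)%N; exists (t ++ t');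
    rewrite IH catA.
have v_size n : (n <= size (v n))%N.
  by elim: n => //= n IH; rewrite size_rcons size_cat ltnS (leq_trans IH)
    ?leq_addr.
pose x i := nth false (v i.+1) i.
have xv n i : (i < size (v n))%N -> x i = nth false (v n) i.
  move=> iv; rewrite /x; have [ni|ni] := leqP n i.+1.
    by have [t ->] := v_le _ _ ni; rewrite nth_cat iv.
  have [t ->] := v_le _ _ (ltnW ni); rewrite nth_cat.
  by have := v_size i.+1; case: ltnP => //; lia.
exists x; apply: QB => // n; exists (size (v n ++ e (n, v n))).
suff -> : mkseq x (size (v n ++ e (n, v n))) = v n ++ e (n, v n).
  exact: (He (n, v n)).
apply: (@eq_from_nth _ false); rewrite size_mkseq // => i lt.
rewrite nth_mkseq // (xv n.+1) /=; last by rewrite size_rcons ltnW.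
by rewrite nth_rcons lt.
Qed.

Lemma comeager_on_concat B w : comeager_on B w ->
  comeager_on [set g | B (concat w g)] [::].
Proof.
move=> [Q [dQ QB]]; exists (fun n v => Q n (w ++ v)); split=> [n t|x _ Qx] /=.
  exact: dQ.
apply: QB => [|n].
  by have := mkseq_concat w x 0; rewrite addn0 cats0.
by have [m Hm] := Qx n; exists (size w + m)%N; rewrite mkseq_concat.
Qed.

(** Some colour class is comeager in a cylinder, hence by density below both extensions of some
    [s_ m]; a common tail then gives an edge inside the class. *)
Lemma G0_no_borel_coloring c : ~ borel_countable_coloring G0 c.
Proof.
move=> [bc Gc]; pose B n := c @^-1` [set n].
have bB n : borel (B n) by apply: bc; exact: discrete_open.
have [[n [t Bt]]|nB] := pselect (exists n t, comeager_on (B n) t); last first.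
  have : comeager_on (\bigcap_n ~` B n) [::].
    apply: comeager_on_bigcap => n; apply: comeager_on_dense => t.
    have [t' [Bt'|Bt']] := borel_comeager_or t (bB n); last by exists t'.
    by exfalso; apply: nB; exists n, (t ++ t').
  by move=> /comeager_on_nonempty[x nBx]; exact: (nBx (c x) I).
have [m [z sm]] := s_dense t.
have Bm b : comeager_on [set g | B n (concat (rcons (s_ m) b) g)] [::].
  by apply: comeager_on_concat; rewrite -cats1 sm; do 2 apply: comeager_on_cat.
(* Two conditions as a countable family: index 0 stands for [true], every other index for
   [false]. *)
have : comeager_on (\bigcap_i [set g | B n (concat (rcons (s_ m) (i == 0%N))
  g)])
    [::].
  by apply: comeager_on_bigcap => i; exact: Bm.
move=> /comeager_on_nonempty[g Hg].
apply: (Gc (concat (rcons (s_ m) false) g) (concat (rcons (s_ m) true) g)).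
  by exists m, g.
by have -> := Hg 1%N I; have -> := Hg 0%N I.
Qed.

End Baire.

(** * Graph properties of G0 and of its symmetrization *)

Section G0Graph.

Lemma G0_irreflexive x : ~ G0 (x, x).
Proof. by move=> /G0P[k [_ -> ]]. Qed.

Lemma G0_antisymmetric x y : G0 (x, y) -> ~ G0 (y, x).
Proof.
move=> /G0P[k [_ xk yk xy]] /G0P[k' [_ yk' xk' _]].
have [e|/xy] := pselect (k' = k); last by rewrite xk' yk'.
by move: xk'; rewrite e xk.
Qed.

Lemma sG0_irreflexive x : ~ sym_closure G0 (x, x).
Proof. by case=> /G0_irreflexive. Qed.

Lemma sG0_sym x y : sym_closure G0 (x, y) -> sym_closure G0 (y, x).
Proof. by case; [right|left]. Qed.

Lemma symmetric_sG0 : symmetric_rel (sym_closure G0).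
Proof. by apply/seteqP; split=> -[x y] H; exact: (sG0_sym H). Qed.

Lemma sG0_edge x y : sym_closure G0 (x, y) -> exists k,
  [/\ mkseq x k = s_ k, mkseq y k = s_ k, x k = ~~ y k &
      forall i, i <> k -> x i = y i].
Proof.
have mk k u v : G0_edge k u v -> mkseq v k = s_ k.
  move=> [<- _ _ uv]; apply/mkseq_inj_nth => i ik; apply/esym/uv; lia.
case=> [|yx]; first move=> /G0P[k E].
  by exists k; have := mk _ _ _ E; case: E => -> xk yk xy ->; rewrite xk yk.
have /G0P[k E] : G0 (y, x) by exact: yx.
exists k; have := mk _ _ _ E; case: E => -> yk xk xy ->; rewrite xk yk.
by split=> // i /xy ->.
Qed.

(* A cycle crosses its edge of maximal level k a second time; since all its
   vertices agree beyond k, both crossings use the same two vertices. *)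
Lemma acyclic_sG0 : acyclic (sym_closure G0).
Proof.
move=> [n [x [n2 xinj xE xc]]].
pose y i := x (i %% n.+1)%N.
have yE i : sym_closure G0 (y i, y i.+1).
  rewrite /y; have lt : (i %% n.+1 < n.+1)%N by rewrite ltn_mod.
  rewrite -[i.+1]addn1 -modnDml addn1.
  move: lt; rewrite ltnS leq_eqVlt => /orP[/eqP ->|lt]; first by rewrite modnn.
  by rewrite (modn_small (_ : _.+1 < n.+1)%N) //; exact: xE.
have /choice[k Hk] := fun i => sG0_edge (yE i).
have yper i : y (i + n.+1)%N = y i by rewrite /y modnDr.
have [j0 j0n i0max] : exists2 i0, (i0 < n.+1)%N &
    forall j, (j < n.+1)%N -> (k j <= k i0)%N.
  exists (val [arg max_(i > (ord0 : 'I_n.+1)) k (val i)]); first exact: ltn_ord.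
  by case: arg_maxnP => // i _ H j jn; exact: (H (Ordinal jn)).
have ymod i : y (i %% n.+1)%N = y i by rewrite /y modn_mod.
have ymodS i : y (i %% n.+1).+1 = y i.+1 by rewrite /y -addn1 modnDml addn1.
pose l i := k (i %% n.+1)%N.
have Hl i : [/\ mkseq (y i) (l i) = s_ (l i), mkseq (y i.+1) (l i) = s_ (l i),
    y i (l i) = ~~ y i.+1 (l i) & forall j, j <> l i -> y i j = y i.+1 j].
  by have := Hk (i %% n.+1)%N; rewrite ymod ymodS.
have j0max i : (l i <= l j0)%N.
  by rewrite /l (modn_small j0n); apply: i0max; rewrite ltn_mod.
pose K := l j0.
have above i a : (K < a)%N -> y i a = y 0%N a.
  move=> Ka; elim: i => // i <-; have [_ _ _ H] := Hl i.
  by apply/esym/H; have := j0max i; rewrite -/K; lia.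
(* Coordinate [K] flips at [j0] and must flip back before the cycle closes; only edges of level [K]
   change it. *)
have [j [j1 j2 jK]] : exists j, [/\ (0 < j)%N, (j < n.+1)%N & l (j0 + j)%N = K].
  apply: contrapT => nj.
  have same j : (j < n.+1)%N -> y (j0 + j.+1)%N K = y j0.+1 K.
    elim: j => [|j IH] jn; first by rewrite addn1.
    rewrite -IH; last exact: ltnW.
    rewrite [(j0 + j.+2)%N]addnS; have [_ _ _ H] := Hl (j0 + j.+1)%N.
    by apply/esym/H => e; apply: nj; exists j.+1; rewrite -e.
  have [_ _ H _] := Hl j0; move: H; rewrite -/K.
  by rewrite -(same n (ltnSn n)) yper; case: (y j0 K).
(* Endpoints of edges of level [K] share the prefix [s_ K] and, by [above], everything beyond
   [K]. *)
have eqy i i' : mkseq (y i) K = s_ K -> mkseq (y i') K = s_ K ->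
    y i K = y i' K -> y i = y i'.
  move=> si si' iK; apply/funext => a; have [aK|Ka|->] := ltngtP a K.
  - have := congr1 (fun s => nth false s a) si; rewrite -si'.
    by rewrite !nth_mkseq.
  - by rewrite (above i) // (above i').
  - exact: iK.
have yinj i i' : (i < i')%N -> (i' < i + n.+1)%N -> y i <> y i'.
  have lt m : (m %% n.+1 <= n)%N by rewrite -ltnS ltn_mod.
  move=> ii' i'n; rewrite /y => /(xinj _ _ (lt i) (lt i')) /eqP.
  rewrite -[i'](subnKC (ltnW ii')) -{1}[i]addn0 eqn_modDl mod0n.
  by rewrite modn_small; lia.
have [s1 s2 d1 _] := Hl j0; have [t1 t2 d2 _] := Hl (j0 + j)%N.
rewrite -/K in s1 s2 d1; rewrite jK in t1 t2 d2.
have [e|e] := eqVneq (y j0 K) (y (j0 + j)%N K).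
  by apply: (yinj j0 (j0 + j)%N); [lia|lia|exact: eqy].
have e1 : y j0.+1 = y (j0 + j)%N.
  by apply: eqy => //; move: e; rewrite d1; case: (y j0.+1 K); case: (y _ K).
have e2 : y (j0 + j).+1 = y j0.
  by apply: eqy => //; move: e; rewrite d2; case: (y j0 K); case: (y _ K).
(* For [j = 1] the cycle would close after two edges, against [2 <= n]; otherwise it passes twice
   through one vertex. *)
have [j1'|j1'] := eqVneq j 1%N.
  apply: (yinj j0 (j0 + j).+1) => //; lia.
by apply: (yinj j0.+1 (j0 + j)%N) => //; lia.
Qed.

End G0Graph.

(** * From Polish spaces to fine metrics *)

Section Polish.
Variable R : realType.
Local Open Scope ring_scope.

Lemma metric_ball_open (X : topologicalType) (d : X -> X -> R) x e :
  is_metric d -> metrizes d -> open [set y | d x y < e].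
Proof.
move=> [m0 ms mt] mz; apply/mz => y /= xy; exists (e - d x y).
  by rewrite subr_gt0.
by move=> z /= yz; have := mt x y z; lra.
Qed.

Lemma polish_separated (X : topologicalType) : polish R X -> separated X.
Proof.
move=> [_ [d [md mz _]]] x y xy; have [m0 ms mt] := md.
have d0 : 0 < d x y / 2.
  rewrite divr_gt0 // lt_neqAle; apply/andP; split.
    by apply/eqP => /esym/m0.
  by have := mt x y x; rewrite (ms y x) (m0 x x).2 //; lra.
exists [set z | d x z < d x y / 2], [set z | d y z < d x y / 2]; split.
- exact: metric_ball_open.
- exact: metric_ball_open.
- by rewrite /= (m0 x x).2.
- by rewrite /= (m0 y y).2.
- apply/seteqP; split=> // z [/= xz yz].
  by have := mt x z y; rewrite (ms z y); lra.
Qed.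

Lemma polish_fine_metric (X : topologicalType) : polish R X ->
  exists d : X -> X -> R, fine_metric d.
Proof.
move=> [[D /countable_injP[enc encI] dD] [d [md mz cd]]]; exists d.
have [m0 ms mt] := md.
have ge0 x y : 0 <= d x y.
  by have := mt x y x; rewrite (ms y x) (m0 x x).2 //; lra.
split=> //.
- move=> u /cd[l ul]; exists l => e e0.
  have : nbhs l [set y | d l y < e].
    apply: open_nbhs_nbhs; split; first exact: metric_ball_open.
    by rewrite /= (m0 l l).2.
  by move=> /ul[N _ HN]; exists N => n; exact: HN.
(* Closed balls of radius e/2 around the points of [D]; a number that [enc] gives to no point of [D]
   yields the empty set. *)
- move=> e e0; exists (fun k => [set x | exists p, [/\ D p,
  enc p = k & d p x <= e / 2]]).
  split=> [x|k].
    have [|p [/= xp Dp]] := dD [set y | d x y < e / 2] _ (metric_ball_open _ _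
      md mz).
      by exists x; rewrite /= (m0 x x).2 // divr_gt0.
    by exists (enc p), p; split=> //; rewrite ms ltW.
  split=> [x nx|x y [p [Dp pk px]] [q [Dq qk qy]]].
    have [[p [Dp pk]]|np] := pselect (exists p, D p /\ enc p = k); last first.
      by exists 1 => // y _ [p [Dp pk _]]; apply: np; exists p.
    exists (d p x - e / 2).
      rewrite subr_gt0 ltNge; apply/negP => px; apply: nx.
      by exists p.
    move=> y xy [q [Dq qk qy]].
    have pq : p = q by apply: encI; rewrite ?inE // pk qk.
    by rewrite -pq in qy; have := mt p y x; rewrite (ms y x); lra.
  have pq : p = q by apply: encI; rewrite ?inE // pk qk.
  by rewrite -pq in qy; have := mt x p y; rewrite (ms x p); lra.
- by move=> U x oU Ux; exact: (mz U).1.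
Qed.

(** The two factors of a potentially F_sigma relation may carry different topologies; the sum of the
    metrics serves both. It is complete because both topologies refine a Hausdorff one, so the two
    limits agree. *)
Lemma fine_metric_join (X : topologicalType) (s t : topology_on X)
    (d1 : with_topology s -> with_topology s -> R)
    (d2 : with_topology t -> with_topology t -> R) :
  separated X -> finer s -> finer t -> fine_metric d1 -> fine_metric d2 ->
  fine_metric (X := X) (fun x y => d1 x y + d2 x y).
Proof.
move=> hX fs ft f1 f2.
have [[a0 as_ at_] c1 C1 o1] := f1; have [[b0 bs bt] c2 C2 o2] := f2.
have ge1 := metric_ge0 f1; have ge2 := metric_ge0 f2.
split.
- split=> [x y|x y|x y z].
  + split=> [e|->]; last by rewrite (a0 y y).2 // (b0 y y).2 // addr0.
    by apply/a0; have := ge1 x y; have := ge2 x y; lra.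
  + by rewrite as_ bs.
  + by have := at_ x y z; have := bt x y z; lra.
- move=> u cu.
  have [|l1 Hl1] := c1 u.
    move=> e /cu[N HN]; exists N => m n Nm Nn.
    by have := HN m n Nm Nn; have := ge2 (u m) (u n); lra.
  have [|l2 Hl2] := c2 u.
    move=> e /cu[N HN]; exists N => m n Nm Nn.
    by have := HN m n Nm Nn; have := ge1 (u m) (u n); lra.
  have e12 : l1 = l2.
    apply: contrapT => /hX[U [V [oU oV Ul Vl UV]]].
    have [e e0 He] := o1 U l1 (fs _ oU) Ul.
    have [e' e'0 He'] := o2 V l2 (ft _ oV) Vl.
    have [N HN] := Hl1 e e0; have [N' HN'] := Hl2 e' e'0.
    have : (U `&` V) (u (maxn N N')).
      by split; [apply/He/HN/leq_maxl|apply/He'/HN'/leq_maxr].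
    by rewrite UV.
  exists l1 => e e0; have e20 : 0 < e / 2 by rewrite divr_gt0.
  have [N HN] := Hl1 _ e20; have [N' HN'] := Hl2 _ e20.
  exists (maxn N N') => n; rewrite geq_max => /andP[Nn N'n].
  by have := HN n Nn; have := HN' n N'n; rewrite -e12; lra.
- move=> e e0; have e20 : 0 < e / 2 by rewrite divr_gt0.
  have [W1 [cov1 H1]] := C1 _ e20; have [W2 [cov2 H2]] := C2 _ e20.
  exists (fun k => if @unpickle (nat * nat)%type k is Some ij
                   then W1 ij.1 `&` W2 ij.2 else set0).
  split=> [x|k].
    have [i Wi] := cov1 x; have [j Wj] := cov2 x; exists (pickle (i, j)).
    by rewrite pickleK.
  case: unpickle => [[i j]|] /=; last first.
    by split=> [x _|x y []//]; exists 1 => // y _ [].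
  split=> [x /not_andP[/((H1 i).1)|/((H2 j).1)] [r r0 Hr]|x y [x1 x2] [y1 y2]].
  + exists r => // y xy [y1 _]; apply: (Hr y) y1.
    by have := ge2 x y; lra.
  + exists r => // y xy [_ y2]; apply: (Hr y) y2.
    by have := ge1 x y; lra.
  + by have := (H1 i).2 x y x1 y1; have := (H2 j).2 x y x2 y2; lra.
- move=> U x oU Ux; have [e e0 He] := o1 U x (fs _ oU) Ux; exists e => // y xy.
  by apply: He; have := ge2 x y; lra.
Qed.

Lemma sieve_comp (X Y : topologicalType) (J J' T : Type) (f : J -> T -> Y)
    (g : J' -> J) (h : J' -> Y -> X) :
  sieve f -> (forall j, continuous (h j)) -> sieve (fun j t => h j (f (g j) t)).
Proof.
move=> [I [W [cov lim]]] ch; exists I, W; split=> // a /lim[t [Wt tO]].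
exists t; split=> // j U oU Ut.
by apply: (tO (g j) (h j @^-1` U)) => //; by have /continuousP := ch j; apply.
Qed.

Lemma analytic_ana2 (X : topologicalType) (A : set (X * X)) :
  analytic R A -> ana2 A.
Proof.
move=> [Y [f [/polish_fine_metric[d fd] cf ->]]].
have [T [g [sg Sg]]] := ana_mclosed fd (@mclosed_setT R Y d).
pose h (b : bool) (y : Y) := if b then (f y).2 else (f y).1.
have ch b : continuous (h b).
  move=> y; case: b; rewrite /h.
    by apply: (@cvg_comp _ _ _ f snd _ _ _ (cf y)); exact: cvg_snd.
  by apply: (@cvg_comp _ _ _ f fst _ _ _ (cf y)); exact: cvg_fst.
apply: (ana_range (sieve_comp (fun=> tt) sg ch)) => p; split.
  move=> [y _ /= fy]; have [t gt] := (Sg (fun=> y)).1 I.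
  exists t; apply/funext => b; rewrite -(congr1 (fun k => k tt) gt) /h fy.
  by case: b.
by move=> [t ->] /=; exists (g tt t) => //; rewrite /h; case: (f _).
Qed.

(** Finite partial unions of the closed sets are closed and increasing, and the joined metric
    dominates the metric of each factor. *)
Lemma pot_Fsigma_stages (X : topologicalType) (F : set (X * X)) :
  separated X -> pot_Fsigma R F ->
  exists (d : X -> X -> R) (Fn : nat -> set (X * X)),
  [/\ fine_metric d, F = \bigcup_n Fn n,
      forall m n, (m <= n)%N -> Fn m `<=` Fn n
    & forall n x y, ~ Fn n (x, y) -> exists2 e, 0 < e &
        forall a b, d x a < e -> d y b < e -> ~ Fn n (a, b)].
Proof.
move=> hX [_ [s [t [fs ps ft pt [G cG FG]]]]].
have [d1 f1] := polish_fine_metric ps; have [d2 f2] := polish_fine_metric pt.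
exists (fun x y => d1 x y + d2 x y), (fun n => \bigcup_(i in `I_n.+1) G i);
  split.
- exact: fine_metric_join.
- rewrite FG; apply/seteqP; split=> [p [i _ Gi]|p [n _ [i _ Gi]]].
    by exists i => //; exists i => /=.
  by exists i.
- by move=> m n mn p [i /= im Gi]; exists i => //=; rewrite (leq_trans im).
- move=> n x y nG.
  have cGn : closed (\bigcup_(i in `I_n.+1) G i).
    by apply: closed_bigcup => //; exact: finite_II.
  have /open_nbhs_nbhs : open_nbhs ((x, y) : with_topology s * with_topology t)
      (~` \bigcup_(i in `I_n.+1) G i).
    by split=> //; exact: closed_openC.
  move=> [[P Q] /= [nP nQ] PQ].
  move: nP nQ; rewrite !nbhsE => -[P' [oP' P'x] PP'] [Q' [oQ' Q'y] QQ'].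
  have [e e0 He] := fm_open f1 oP' P'x; have [r r0 Hr] := fm_open f2 oQ' Q'y.
  exists (Num.min e r); first by rewrite lt_min e0.
  move=> a b; rewrite !lt_min => /andP[xa _] /andP[_ yb].
  apply: (PQ (a, b)); split=> /=.
    by apply/PP'/He; have := metric_ge0 f2 x a; lra.
  by apply/QQ'/Hr; have := metric_ge0 f1 y b; lra.
Qed.

(** The colour of a point is the least index of a set containing it. *)
Lemma borel_coloring_of_cover (X : topologicalType) (A : set (X * X))
    (C : nat -> set X) :
  (forall i, borel (C i) /\ forall x y, C i x -> C i y -> ~ A (x, y)) ->
  (forall x, exists i, C i x) -> exists c, borel_countable_coloring A c.
Proof.
move=> iC cov.
have /choice[c Hc] : forall x, exists n, C n x /\ forall i,
  (i < n)%N -> ~ C i x.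
  move=> x; have [i Ci] := cov x.
  have [|n /asboolP Cn nmin] := @ex_minnP (fun n => `[<C n x>]).
    by exists i; exact/asboolP.
  exists n; split=> // j jn Cj.
  by have := nmin j (asboolT Cj); rewrite leqNgt jn.
exists c; split=> [U _|x y Axy cxy]; last first.
  by apply: (iC (c x)).2 Axy; [exact: (Hc x).1|rewrite cxy; exact: (Hc y).1].
have -> : c @^-1` U = \bigcup_n (if `[<U n>] then
    C n `&` \bigcap_i (if (i < n)%N then ~` C i else setT) else set0).
  apply/seteqP; split=> [x Ux|x [n _]].
    exists (c x) => //; rewrite asboolT //; split; first exact: (Hc x).1.
    by move=> i _; case: ifP => // /((Hc x).2 i).
  case: asboolP => // Un [Cn nC]; rewrite /preimage /=.
  suff -> : c x = n by [].
  have [lt|lt|//] := ltngtP (c x) n.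
    by have := nC (c x) I; rewrite lt => /(_ (Hc x).1).
  by case: ((Hc x).2 n lt).
apply: borel_bigcup => n; case: asboolP => _; last exact: borel_set0.
apply: borel_setI; first exact: (iC n).1.
apply: borel_bigcap => i; case: ifP => _; last exact: borel_setT.
by apply: borel_setC; exact: (iC i).1.
Qed.

Lemma injective_homomorphism_of_uncolorable (X : topologicalType)
    (A F : set (X * X)) :
  polish R X -> ana2 A -> (forall x, ~ A (x, x)) -> A `<=` F ->
  symmetric_rel F -> acyclic F -> pot_Fsigma R F ->
  (~ exists c, borel_countable_coloring A c) ->
  exists f : cantor_space -> X,
  [/\ injective f, continuous f, forall x y, G0 (x, y) -> A (f x, f y)
    & forall x y, x <> y -> F (f x, f y) -> sym_closure G0 (x, y)].
Proof.
move=> pX aA irrA AF symF acF pF nc; have hX := polish_separated pX.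
have [d [Fn [fd FE FnS cFn]]] := pot_Fsigma_stages hX pF.
have [SA [aSA SA0 SAS SAd SAl]] := ana_scheme aA.
apply: (injective_homomorphism fd hX aA irrA AF symF acF _ cFn _ aSA SA0 SAS SAd
  SAl).
- by move=> n p Fp; rewrite FE; exists n.
- move=> C iC; apply: contrapT => H; apply: nc.
  apply: (borel_coloring_of_cover iC) => x; apply: contrapT => nx; apply: H.
  by exists x => i Ci; apply: nx; exists i.
- exact: FnS.
- by rewrite FE.
Qed.

End Polish.

(** * The three spaces *)

Section SequenceSpace.
Variables (R : realType) (V : uniformType) (enc : V -> nat) (dec : nat -> V).
Hypotheses (dV : forall v : V, open [set v]) (encK : cancel enc dec).
Local Open Scope ring_scope.
Local Notation S := (prod_topology (fun _ : nat => V)).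

Lemma first_difference (x y : S) : x <> y ->
  exists k, x k <> y k /\ mkseq x k = mkseq y k.
Proof.
move=> xy; have [|k /asboolP xk kmin] := @ex_minnP (fun k => `[<x k <> y k>]).
  apply: contrapT => H; apply: xy; apply/funext => k; apply: contrapT => xk.
  by apply: H; exists k; exact/asboolP.
exists k; split=> //; apply/mkseq_inj_nth => i ik; apply: contrapT => xi.
by have := kmin i (asboolT xi); rewrite leqNgt ik.
Qed.

(** The standard ultrametric on sequences, given by the first difference. *)
Definition seq_dist (x y : S) : R :=
  if pselect (x <> y) is left xy then (sval (cid (first_difference
    xy))).+1%:R^-1
  else 0.

Lemma seq_distP x y : (x = y /\ seq_dist x y = 0) \/
  exists k, [/\ x k <> y k, mkseq x k = mkseq y k & seq_dist x y = k.+1%:R^-1].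
Proof.
rewrite /seq_dist; case: pselect => [xy|nxy]; last by left; split=> //;
  exact: contrapT.
by right; case: cid => k [xk yk] /=; exists k.
Qed.

Lemma seq_dist_lt x y n :
  seq_dist x y < n.+1%:R^-1 <-> mkseq x n.+1 = mkseq y n.+1.
Proof.
have [[-> ->]|[k [xk xyk ->]]] := seq_distP x y; first by rewrite invr_gt0.
rewrite ltf_pV2 ?posrE ?ltr0n // ltr_nat ltnS; split=> [nk|/mkseq_inj_nth e].
  apply/mkseq_inj_nth => i ilt; move/mkseq_inj_nth : xyk; apply; lia.
by rewrite ltnNge; apply/negP => kn; apply: xk; apply: e; lia.
Qed.

Lemma seq_dist_metric : is_metric seq_dist.
Proof.
have d0 x y : seq_dist x y = 0 <-> x = y.
  have [[xy ->]//|[k [xk _ ->]]] := seq_distP x y.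
  split=> [/eqP|xy]; first by rewrite invr_eq0 pnatr_eq0.
  by case: xk; rewrite xy.
split=> // [x y|x y z].
  have [e|ne] := pselect (x = y); first by rewrite e.
  have [[/ne//]|[k [xk xyk ->]]] := seq_distP x y.
  have [[/esym/ne//]|[j [yj yxj ->]]] := seq_distP y x.
  suff -> : k = j by [].
  move/mkseq_inj_nth : xyk => xyk; move/mkseq_inj_nth : yxj => yxj.
  have [lt|lt|//] := ltngtP k j; first by case: xk; rewrite yxj.
  by case: yj; rewrite xyk.
have [[-> ->]|[k [xk xyk ->]]] := seq_distP x y; first by rewrite add0r.
have [[<- ->]|[j [yj yzj ->]]] := seq_distP y z.
  rewrite addr0; have [[_ ->]|[i [xi xyi ->]]] := seq_distP x y.
    by rewrite invr_ge0.
  rewrite lef_pV2 ?posrE ?ltr0n // ler_nat ltnS leqNgt; apply/negP => ik.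
  by apply: xi; move/mkseq_inj_nth: xyk; apply.
have [[_ ->]|[i [xi xzi ->]]] := seq_distP x z;
  first by rewrite addr_ge0 // invr_ge0.
have [ki|ik] := leqP k i.
  rewrite (@le_trans _ _ k.+1%:R^-1) ?lerDl ?invr_ge0 //.
  by rewrite lef_pV2 ?posrE ?ltr0n // ler_nat.
have [ji|ij] := leqP j i.
  rewrite (@le_trans _ _ j.+1%:R^-1) ?lerDr ?invr_ge0 //.
  by rewrite lef_pV2 ?posrE ?ltr0n // ler_nat.
case: xi; move/mkseq_inj_nth: xyk => ->//.
by move/mkseq_inj_nth: yzj => ->.
Qed.

Lemma seq_dist_metrizes : metrizes seq_dist.
Proof.
move=> U; split=> [oU x Ux|H].
  have [n Hn] := cylinder_nbhs (open_nbhs_nbhs (conj oU Ux)).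
  exists n.+1%:R^-1; first by rewrite invr_gt0.
  move=> y /= /seq_dist_lt xy; apply: Hn.
  by rewrite -(take_mkseq y (leqnSn n)) -xy take_mkseq.
rewrite openE => x /H[e e0 He]; have [N HN] := inv_succ_lt e0.
rewrite /interior; apply: filterS (nbhs_cylinder dV x N.+1) => y /= yx.
apply: He => /=; apply: lt_trans (HN N (leqnn N)).
by apply/seq_dist_lt; rewrite yx.
Qed.

Lemma polish_sequence_space : polish R S.
Proof.
split.
  (* The dense set consists of the sequences [dec 0] from some place on, with arbitrary coded
     letters before. *)
  exists (range (fun w : seq nat => (fun i => dec (nth 0%N w i)) : S)).
    exact: sub_countable (card_image_le _ _) (countableP _).
  move=> U [x Ux] oU; have [n Hn] :=
    cylinder_nbhs (open_nbhs_nbhs (conj oU Ux)).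
  eexists; split; last by exists (mkseq (fun i => enc (x i)) n).
  by apply: Hn; apply/mkseq_inj_nth => i lt; rewrite nth_mkseq.
exists seq_dist; split; [exact: seq_dist_metric|exact: seq_dist_metrizes|].
move=> u cu.
have /choice[N HN] : forall n, exists N, forall m, (N <= m)%N ->
    mkseq (u m) n.+1 = mkseq (u N) n.+1.
  move=> n; have [|N HN] := cu n.+1%:R^-1; first by rewrite invr_gt0.
  by exists N => m Nm; apply/seq_dist_lt; apply: HN.
pose l : S := fun i => u (N i) i.
have lE n m : (N n <= m)%N -> mkseq (u m) n.+1 = mkseq l n.+1.
  move=> Nm; apply/mkseq_inj_nth => i lt; rewrite /l.
  have /mkseq_inj_nth/(_ i (ltnSn i)) <- :=
    HN i (maxn (N n) (N i)) (leq_maxr _ _).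
  have /mkseq_inj_nth/(_ i lt) -> := HN n (maxn (N n) (N i)) (leq_maxl _ _).
  by have /mkseq_inj_nth/(_ i lt) -> := HN n m Nm.
exists l => U /cylinder_nbhs[n Hn]; exists (N n) => // m /= Nm; apply: Hn.
by rewrite -(take_mkseq (u m) (leqnSn n)) lE // take_mkseq.
Qed.

End SequenceSpace.

Section OriginalTopology.
Variables (R : realType) (X : topologicalType).

(** The topology of [X] packaged as data: a Borel set that is already F_sigma is then potentially
    F_sigma with no change of topology. *)
Definition original_topology : topology_on X.
Proof.
apply: (@TopologyOn X (@open X)); first exact: openT.
  by move=> U V; exact: openI.
by move=> D oD; apply: bigcup_open.
Defined.

Lemma nbhs_original (x : X) :
  nbhs (x : with_topology original_topology) = nbhs x.
Proof. by rewrite !nbhsE. Qed.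

Lemma polish_original : polish R X ->
  polish R (with_topology original_topology).
Proof.
move=> [[D cD dD] [d [md mz cd]]]; split; first by exists D.
exists d; split=> // u /cd[l ul]; exists l; rewrite /cvg_to nbhs_original.
exact: ul.
Qed.

Lemma pot_Fsigma_of_Fsigma (F : set (X * X)) : polish R X -> borel F ->
  (exists G : nat -> set (X * X),
    (forall n, closed (G n : set (with_topology original_topology *
                                  with_topology original_topology))) /\
    F = \bigcup_n G n) -> pot_Fsigma R F.
Proof.
move=> pX bF [G [cG FG]]; split=> //;
  exists original_topology, original_topology.
by split=> //; [exact: polish_original|exact: polish_original|exists G].
Qed.

End OriginalTopology.

Section ThreeSpaces.
Variable R : realType.

Lemma polish_cantor : polish R cantor_space.
Proof. exact: (@polish_sequence_space R bool nat_of_bool odd bool_open oddb).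
  Qed.

Lemma nat_open (n : nat) : open [set n].
Proof. exact: discrete_open. Qed.

Lemma polish_baire : polish R (prod_topology (fun _ : nat => nat)).
Proof. exact: (@polish_sequence_space R nat id id nat_open). Qed.

(** A point of Baire space codes an edge: the entry at 0 is kept for its level, and the parities of
    the later entries give the common tail. *)
Definition G0_point (n : nat) (b : bool) (a : nat -> nat) : cantor_space :=
  concat (rcons (s_ n) b) (fun i => odd (a i.+1)).

(* e codes the level and the orientation of the edges. *)
Lemma analytic_edges (e : nat -> nat * bool) :
  analytic R (range (fun a : nat -> nat =>
    (G0_point (e (a 0%N)).1 (e (a 0%N)).2 a,
     G0_point (e (a 0%N)).1 (~~ (e (a 0%N)).2) a))).
Proof.
exists (prod_topology (fun _ : nat => nat)), (fun a =>
    (G0_point (e (a 0%N)).1 (e (a 0%N)).2 a,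
     G0_point (e (a 0%N)).1 (~~ (e (a 0%N)).2) a)); split=> //.
  exact: polish_baire.
move=> a U [[P Q] /= [nP nQ] PQ].
have [n Hn] := cylinder_nbhs nP; have [m Hm] := cylinder_nbhs nQ.
apply: filterS (nbhs_cylinder nat_open a (maxn n m).+1) =>
  b /= /mkseq_inj_nth ba.
apply: PQ; split=> /=.
  apply: Hn; apply/mkseq_inj_nth => i lt; rewrite ba // /G0_point /concat.
  by case: ltnP => // _; rewrite ba //; lia.
apply: Hm; apply/mkseq_inj_nth => i lt; rewrite ba // /G0_point /concat.
by case: ltnP => // _; rewrite ba //; lia.
Qed.

Lemma G0_point_code n (g : cantor_space) : exists a : nat -> nat,
  a 0%N = n /\ forall m c, G0_point m c a = concat (rcons (s_ m) c) g.
Proof.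
exists (fun i => if i is j.+1 then nat_of_bool (g j) else n); split=> // m c.
by rewrite /G0_point; congr concat; apply/funext => i /=; case: (g i).
Qed.

Lemma analytic_G0 : analytic R G0.
Proof.
have := analytic_edges (fun n => (n, false)); congr analytic.
apply/seteqP; split=> [_ [a _ <-]|_ [n [g ->]]].
  by exists (a 0%N), (fun i => odd (a i.+1)).
have [a [a0 aE]] := G0_point_code n g.
by exists a => //=; rewrite !aE a0.
Qed.

Lemma analytic_sG0 : analytic R (sym_closure G0).
Proof.
have := analytic_edges (fun n => (n./2, odd n)); congr analytic.
apply/seteqP; split=> [_ [a _ <-]|[x y] [[n [g [-> ->]]]|[n [g [-> ->]]]]] /=.
- case: (odd (a 0%N)); [right|left]; exists (a 0%N)./2, (fun i => odd (a i.+1));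
  by [].
- have [a [a0 aE]] := G0_point_code n.*2 g.
  by exists a => //=; rewrite !aE a0 doubleK odd_double.
- have [a [a0 aE]] := G0_point_code n.*2.+1 g.
  by exists a => //=; rewrite !aE a0 /= uphalf_double odd_double.
Qed.

Definition sG0_level k : set (cantor_space * cantor_space) :=
  [set p | G0_edge k p.1 p.2 \/ G0_edge k p.2 p.1].

Lemma sG0_levels : sym_closure G0 = \bigcup_k sG0_level k.
Proof.
apply/seteqP; split=> [[x y]|[x y] [k _ [E|E]]].
- move=> [xy|yx].
    by have /G0P[k E] := xy; exists k => //; left.
  have /G0P[k E] : G0 (y, x) by exact: yx.
  by exists k => //; right.
- by left; apply/G0P; exists k.
- by right; apply/(G0P y x); exists k.
Qed.

(** The failure is visible either at a coordinate other than [k] where the points differ, or within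
    the first k+1 coordinates. *)
Lemma G0_edge_prefix k (x y : cantor_space) : ~ G0_edge k x y ->
  exists n, forall x' y' : cantor_space,
    mkseq x' n = mkseq x n -> mkseq y' n = mkseq y n -> ~ G0_edge k x' y'.
Proof.
move=> nE; have [E|ne] := pselect (exists i, i <> k /\ x i <> y i).
  have [i [ik xyi]] := E; exists i.+1 =>
    x' y' /mkseq_inj_nth xx /mkseq_inj_nth yy.
  by move=> [_ _ _ /(_ i ik)]; rewrite xx ?yy.
exists k.+1 => x' y' xx yy [E1 E2 E3 E4]; apply: nE.
have /mkseq_inj_nth xx' := xx; have /mkseq_inj_nth yy' := yy.
split; rewrite -?xx' -?yy' //.
  by rewrite -(take_mkseq x (leqnSn k)) -xx take_mkseq.
by move=> i ik; apply: contrapT => xi; apply: ne; exists i.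
Qed.

(** The map [c] lets one statement cover Cantor space and its copy under [original_topology]. *)
Lemma closed_sG0_level (T : topologicalType) (c : T -> cantor_space) k :
  (forall x n, nbhs x [set y | mkseq (c y) n = mkseq (c x) n]) ->
  closed [set p : T * T | sG0_level k (c p.1, c p.2)].
Proof.
move=> cc; rewrite -[X in closed X]setCK; apply: open_closedC.
rewrite openE => -[x y] /= /not_orP[/G0_edge_prefix[n Hn] /G0_edge_prefix[m
  Hm]].
pose N := maxn n m.
exists ([set x' | mkseq (c x') N = mkseq (c x) N],
        [set y' | mkseq (c y') N = mkseq (c y) N]) => /=.
  by split; exact: cc.
have tk (u v : nat -> bool) j : (j <= N)%N -> mkseq u N = mkseq v N ->
    mkseq u j = mkseq v j.
  by move=> jN e; rewrite -(take_mkseq u jN) e take_mkseq.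
move=> [x' y'] [/= xx yy] []; [apply: Hn|apply: Hm];
  by apply: tk; rewrite ?leq_maxl ?leq_maxr.
Qed.

Lemma pot_Fsigma_sG0 : pot_Fsigma R (sym_closure G0).
Proof.
apply: pot_Fsigma_of_Fsigma; first exact: polish_cantor.
  rewrite sG0_levels; apply: borel_bigcup => k.
  rewrite -[X in borel X]setCK; apply: borel_setC; apply: borel_open.
  apply: closed_openC; apply: (@closed_sG0_level cantor_space id) => x n.
  exact: nbhs_cylinder bool_open x n.
exists sG0_level; split=> [k|]; last exact: sG0_levels.
apply: (@closed_sG0_level (with_topology (original_topology cantor_space)) id)
  => x n.
rewrite nbhs_original; exact: nbhs_cylinder bool_open x n.
Qed.

Lemma polish_loop : polish R (discrete_topology 'I_1).
Proof.
split.
  exists setT; last by move=> U [x Ux] _; exists x.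
  apply/countable_injP; exists (fun=> 0%N) => x y _ _ _.
  by rewrite (ord1 x) (ord1 y).
exists (fun _ _ => 0%R); split.
- by split=> [x y|x y|x y z]; rewrite ?addr0 // (ord1 x) (ord1 y).
- move=> U; split=> [_ x Ux|_]; last exact: discrete_open.
  by exists 1%R => // y _; rewrite (ord1 y) -(ord1 x).
- move=> u _; exists ord0 => U /nbhs_singleton U0.
  by exists 0%N => // n _ /=; rewrite (ord1 (u n)).
Qed.

Lemma loop_relE : @rel_of loop_space = setT.
Proof. by apply/seteqP; split=> // -[x y] _ /=; rewrite (ord1 x) (ord1 y). Qed.

Lemma class_C_loop : class_C R loop_space.
Proof.
have pL := polish_loop.
split=> //.
- exists (discrete_topology 'I_1), (fun x => (x, x)); split=> //.
    move=> x U /nbhs_singleton Ux; apply: filterE => -[a b].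
    by move: Ux; rewrite (ord1 x) (ord1 a) (ord1 b).
  apply/seteqP; split=> [p ->|_ [x _ <-]]; first by exists ord0.
  by rewrite (ord1 x).
- exists setT; split=> //; last first.
    apply: pot_Fsigma_of_Fsigma => //; first exact: borel_setT.
    exists (fun=> setT); split=> [n|]; first exact: closedT.
    by apply/seteqP; split=> // p _; exists 0%N.
  move=> [n [x [n2 xinj _ _]]]; suff : 0%N = 1%N by [].
  apply: xinj => //; first exact: leq_trans n2.
  by rewrite (ord1 (x 0%N)) (ord1 (x 1%N)).
- by move=> [c [_ /(_ ord0 ord0 erefl)]].
Qed.

End ThreeSpaces.

(** * The basis *)

Section Basis.
Variable R : realType.

Lemma ana2_setI (X : topologicalType) (A B : set (X * X)) :
  separated X -> ana2 A -> ana2 B -> ana2 (A `&` B).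
Proof. by move=> hX; exact: ana_setI. Qed.

Lemma ana2_transpose (X : topologicalType) (A : set (X * X)) :
  separated X -> ana [set: unit -> X] -> ana2 A -> ana2 A^-1%relation.
Proof. by move=> hX aT aA; exact: (@ana_preim X bool bool negb _ hX aT aA). Qed.

Lemma ana2_square (X : topologicalType) (B : set X) :
  separated X -> ana [set: unit -> X] -> ana1 B -> ana2 (B `*` B).
Proof.
move=> hX aT aB; apply: ana_setI => //.
  exact: (@ana_preim X bool unit (fun=> false) [set p | B (p tt)] hX aT aB).
exact: (@ana_preim X bool unit (fun=> true) [set p | B (p tt)] hX aT aB).
Qed.

(** Otherwise the colorings on the single classes, paired with [c], would color all of [A]. *)
Lemma colored_class_uncolorable (X : topologicalType) (A : set (X * X))
    (c : X -> nat) : borel_map c ->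
  (~ exists c', borel_countable_coloring A c') ->
  exists n, ~ exists c',
    borel_countable_coloring (A `&` (c @^-1` [set n] `*` c @^-1` [set n])) c'.
Proof.
move=> bc nA; apply: contrapT => H; apply: nA.
have /choice[c' Hc'] : forall n, exists c',
    borel_countable_coloring (A `&` (c @^-1` [set n] `*` c @^-1` [set n])) c'.
  by move=> n; apply: contrapT => Hn; apply: H; exists n.
exists (fun x => pickle (c x, c' (c x) x)); split=> [U _|x y Axy].
  rewrite [X in borel X](_ : _ = \bigcup_n (c @^-1` [set n] `&`
    c' n @^-1` [set k | U (pickle (n, k))])); last first.
    apply/seteqP; split=> [x Ux|x [n _ [/= <- Uk //]]].
    by exists (c x).
  apply: borel_bigcup => n; apply: borel_setI.
    by apply: bc; exact: nat_open.
  by apply: (Hc' n).1; exact: discrete_open.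
move=> /(pcan_inj (@pickleK (nat * nat)%type)) [cxy]; rewrite -cxy.
by apply: (Hc' (c x)).2.
Qed.

Lemma class_C_embeds P : class_C R P -> exists2 Q, three_spaces Q & embeds Q P.
Proof.
case: P => X A [/= pX anA [F [symF acF pF AF]] nc].
have hX := polish_separated pX; have [d fd] := polish_fine_metric pX.
have aT : ana [set: unit -> X] := ana_mclosed fd (@mclosed_setT R X d).
have aA := analytic_ana2 anA.
have [[x Axx]|irr] := pselect (exists x, A (x, x)).
  exists loop_space; first by constructor 1.
  exists (fun=> x); split=> [a b _|a|a b]; first by rewrite (ord1 a) (ord1 b).
    exact: cvg_cst.
  by rewrite loop_relE.
have irrA x : ~ A (x, x) by move=> Axx; apply: irr; exists x.
have sub x y f : A (f x, f y) -> x <> y :> cantor_space.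
  by move=> Af xy; apply: (irrA (f x)); rewrite {2}xy.
have [[c [bc Sc]]|nS] := pselect
    (exists c, borel_countable_coloring (A `&` A^-1%relation) c); last first.
  (* The homomorphism goes into the symmetric part, but its last property concerns [F] and so
     controls all of [A]. *)
  have [|||f [fI fC fG fF]] := @injective_homomorphism_of_uncolorable R X
    (A `&` A^-1%relation) F pX _ _ _ symF acF pF nS.
  - by apply: ana2_setI => //; exact: ana2_transpose.
  - by move=> x [/irrA].
  - by move=> p [/AF].
  exists sG0_space; first by constructor 3.
  exists f; split=> //= x y; split=> [Af|[/fG[]//|]].
    by apply: fF; [exact: (sub x y f)|exact: AF].
  by move=> yx; have [] := fG y x yx.
have [n nn] := colored_class_uncolorable bc nc.
have bB : borel (c @^-1` [set n]) by by apply: bc; exact: nat_open.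
have [|||f [fI fC fG fF]] := @injective_homomorphism_of_uncolorable R X
    (A `&` (c @^-1` [set n] `*` c @^-1` [set n])) F pX _ _ _ symF acF pF nn.
- apply: ana2_setI => //; apply: ana2_square => //.
  exact: (ana_borel fd).
- by move=> x [/irrA].
- by move=> p [/AF].
exists G0_space; first by constructor 2.
exists f; split=> //= x y; split=> [Af|/fG[]//].
(* If [(y, x)] were in [G0] instead, the values would be joined both ways inside one class of [c],
   which colors the symmetric part. *)
have [//|yx] := fF x y (sub x y f Af) (AF _ Af).
have [Ayx [/= cy cx]] := fG y x yx.
by case: (Sc (f x) (f y)) => //; rewrite cx cy.
Qed.

Lemma diagonalE (X : Type) (x y : X) : diagonal (x, y) <-> x = y.
Proof. by []. Qed.

Lemma irreflexive_relP (X : Type) (A : set (X * X)) :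
  irreflexive_rel A <-> forall x, ~ A (x, x).
Proof.
split=> [A0 x Axx|irr]; first by have : (A `&` diagonal) (x, x) by [];
  rewrite A0.
by apply/seteqP; split=> // -[x y] [Axy] /diagonalE xy; apply: (irr x);
  rewrite {2}xy.
Qed.

Lemma no_coloring_G0 : no_borel_countable_coloring G0_space.
Proof. by move=> [c /G0_no_borel_coloring]. Qed.

Lemma no_coloring_sG0 : no_borel_countable_coloring sG0_space.
Proof.
move=> [c [bc Gc]]; apply: (@G0_no_borel_coloring c); split=> // x y xy.
by apply: Gc; left.
Qed.

Lemma class_C_G0 : class_C R G0_space.
Proof.
split; [exact: polish_cantor|exact: analytic_G0| |exact: no_coloring_G0].
exists (sym_closure G0); split=> [|||p];
  [exact: symmetric_sG0|exact: acyclic_sG0|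
  exact: pot_Fsigma_sG0|by left].
Qed.

Lemma class_C_sG0 : class_C R sG0_space.
Proof.
split; [exact: polish_cantor|exact: analytic_sG0| |exact: no_coloring_sG0].
exists (sym_closure G0); split=> //; [exact: symmetric_sG0|exact: acyclic_sG0|
  exact: pot_Fsigma_sG0].
Qed.

Lemma graph_sG0 : graph (sym_closure G0).
Proof.
by split; [apply/irreflexive_relP; exact: sG0_irreflexive|exact: symmetric_sG0].
Qed.

Lemma in_graph_sG0 (A : set (cantor_space * cantor_space)) :
  A `<=` sym_closure G0 -> in_pot_Fsigma_acyclic_graph R (RelSpace A).
Proof.
move=> AG; exists (sym_closure G0); split=> //.
- exact: graph_sG0.
- exact: acyclic_sG0.
- exact: pot_Fsigma_sG0.
Qed.

Lemma class_C_of_graph (P : relspace) : polish R P -> analytic R (@rel_of P) ->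
  in_pot_Fsigma_acyclic_graph R P -> no_borel_countable_coloring P ->
    class_C R P.
Proof.
by move=> pP aP [F [[_ sF] acF pF AF]] nP; split=> //; exists F.
Qed.

Lemma G0_edge0 : exists x y : cantor_space, G0 (x, y).
Proof.
exists (concat (rcons (s_ 0) false) (fun=> false)).
by exists (concat (rcons (s_ 0) true) (fun=> false)), 0%N, (fun=> false).
Qed.

Lemma loop_embeds P : embeds loop_space P -> exists x, @rel_of P (x, x).
Proof. by move=> [f [_ _ H]]; exists (f ord0); apply/H; rewrite loop_relE. Qed.

Lemma cantor_embeds_loop (A : set (cantor_space * cantor_space)) :
  ~ embeds (RelSpace A) loop_space.
Proof.
move=> [f [fI _ _]].
have /(congr1 (fun x => x 0%N)) // : (fun=> true) = (fun=>
  false) :> cantor_space.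
by apply: fI; rewrite (ord1 (f _)) (ord1 (f (fun=> false))).
Qed.

Lemma G0_embeds_asymmetric P : embeds G0_space P -> ~ symmetric_rel (@rel_of P).
Proof.
move=> [f [_ _ H]] sP; have [x [y xy]] := G0_edge0.
apply: (G0_antisymmetric xy); apply/(H y x).
by rewrite sP; apply/(H x y).
Qed.

Lemma sG0_embeds_symmetric P : embeds sG0_space P ->
  exists x y, x <> y /\ @rel_of P (x, y) /\ @rel_of P (y, x).
Proof.
move=> [f [fI _ H]]; have [x [y xy]] := G0_edge0; exists (f x), (f y).
split=> [/fI exy|]; first by move: xy; rewrite exy; exact: G0_irreflexive.
by split; apply/H; [left|right].
Qed.

Lemma antichain_three_spaces : is_antichain three_spaces.
Proof.
have LG : ~ embeds loop_space G0_space by move=>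
  /loop_embeds[x /G0_irreflexive].
have LS : ~ embeds loop_space sG0_space by move=>
  /loop_embeds[x /sG0_irreflexive].
have GL : ~ embeds G0_space loop_space := @cantor_embeds_loop _.
have SL : ~ embeds sG0_space loop_space := @cantor_embeds_loop _.
have GS : ~ embeds G0_space sG0_space.
  by move=> /G0_embeds_asymmetric; apply; exact: symmetric_sG0.
have SG : ~ embeds sG0_space G0_space.
  by move=> /sG0_embeds_symmetric[x [y [_ [/G0_antisymmetric]]]].
by move=> P Q [] -> [] ->.
Qed.

(** Of the three candidates, irreflexivity rules out the loop and antisymmetry rules out
    [sG0_space]. *)
Lemma G0_minimum : is_minimum (class_oriented_graphs R) G0_space.
Proof.
have GC : class_oriented_graphs R G0_space.
  split; [exact: polish_cantor|exact: analytic_G0| | |exact: no_coloring_G0].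
    split; first by apply/irreflexive_relP; exact: G0_irreflexive.
    by move=> [x y] [xy yx]; case: (G0_antisymmetric xy).
  by apply: in_graph_sG0 => p; left.
split=> //; split=> [P -> //|P [pP aP [iP anP] gP nP]].
exists G0_space => //.
have [Q [] -> //] := class_C_embeds (class_C_of_graph pP aP gP nP).
  by move=> /loop_embeds[x]; move/irreflexive_relP: iP => /(_ x).
move=> /sG0_embeds_symmetric[x [y [xy [Axy Ayx]]]].
by case: xy; apply: (anP (x, y)).
Qed.

Lemma sG0_minimum : is_minimum (class_graphs R) sG0_space.
Proof.
have GC : class_graphs R sG0_space.
  split; [exact: polish_cantor|exact: analytic_sG0|exact: graph_sG0| |
    exact: no_coloring_sG0].
  exact: in_graph_sG0.
split=> //; split=> [P -> //|P [pP aP [iP sP] gP nP]].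
exists sG0_space => //.
have [Q [] -> //] := class_C_embeds (class_C_of_graph pP aP gP nP).
  by move=> /loop_embeds[x]; move/irreflexive_relP: iP => /(_ x).
by move=> /G0_embeds_asymmetric.
Qed.

End Basis.

Theorem theorem1p8 (R : realType) :
  [/\ is_basis (class_C R) three_spaces,
      is_antichain three_spaces,
      is_minimum (class_oriented_graphs R) G0_space
    & is_minimum (class_graphs R) sG0_space].
Proof.
split; [split=> P|exact: antichain_three_spaces|exact: G0_minimum|exact:
  sG0_minimum].
  by case=> ->; [exact: class_C_loop|exact: class_C_G0|exact: class_C_sG0].
exact: class_C_embeds.
Qed.
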